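(* Let $\phi\in\mathcal{S}_2$ and assume $\tau=(\tau^1,\tau^2)\in\partial\mathbb{D}^2$ is a B-point for $\phi$ such that $\phi(\tau)=\tau^1$. Assume also that $\phi\neq\pi^1$. Set $$K_\tau(M)=\frac{D_{-(\tau^1,\tau^2M)}\phi(\tau)}{-\phi(\tau)}\qquad(M>0).$$ (a) If $|\tau^2|<1$, then $\tau$ is a left Type I DW point that is also a C-point for $\phi$ if and only if there is a constant $\alpha\le1$ with $K_\tau(M)=\alpha$ for all $M>0$. In any other case, $\tau$ is neither a left Type I nor a left Type II DW point. (b) If $|\tau^2|=1$, then $\tau$ is a: (i) left Type I DW point that is also a C-point if and only if there is a constant $\alpha\le1$ with $K_\tau(M)=\alpha$ for all $M>0$; (ii) left Type I DW point that is not a C-point if and only if $K_\tau(M)$ is non-constant in $M$ and $K_\tau(M)<1$ for all $M>0$; (iii) left Type II DW point if and only if $K_\tau(M)$ is non-constant in $M$ and there exists $A>0$ such that $K_\tau(A)=1$; (iv) neither a left Type I nor a left Type II DW point if and only if $K_\tau(M)>1$ for all $M>0$. The analogous statement holds for right Type I/II DW points: let $\phi\in\mathcal{S}_2$, $\phi\ne\pi^2$, let $\tau=(\tau^1,\tau^2)\in\partial\mathbb{D}^2$ be a B-point for $\phi$ with $\phi(\tau)=\tau^2$, and set $$\widetilde K_\tau(M)=\frac{D_{-(\tau^1M,\tau^2)}\phi(\tau)}{-\phi(\tau)}\qquad(M>0).$$ (a') If $|\tau^1|<1$, then $\tau$ is a right Type I DW point that is also a C-point for $\phi$ if and only if there is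 a constant $\alpha\le1$ with $\widetilde K_\tau(M)=\alpha$ for all $M>0$. In any other case, $\tau$ is neither a right Type I nor a right Type II DW point. (b') If $|\tau^1|=1$, then $\tau$ is a: (i') right Type I DW point that is also a C-point if and only if there is a constant $\alpha\le1$ with $\widetilde K_\tau(M)=\alpha$ for all $M>0$; (ii') right Type I DW point that is not a C-point if and only if $\widetilde K_\tau(M)$ is non-constant in $M$ and $\widetilde K_\tau(M)<1$ for all $M>0$; (iii') right Type II DW point if and only if $\widetilde K_\tau(M)$ is non-constant in $M$ and there exists $A>0$ such that $\widetilde K_\tau(A)=1$; (iv') neither a right Type I nor a right Type II DW point if and only if $\widetilde K_\tau(M)>1$ for all $M>0$.
   Context: Notation. $\mathbb{D}$ is the open unit disk, $\mathbb{T}=\partial\mathbb{D}$, $\mathbb{H}=\{z\in\mathbb{C}:\Re z>0\}$, $\mathrm{cl}$ denotes closure. Superscripts $1,2$ are coordinate indices: $\lambda=(\lambda^1,\lambda^2)$. $\|(\lambda^1,\lambda^2)\|=\max\{|\lambda^1|,|\lambda^2|\}$. $\pi^i(\lambda)=\lambda^i$ are the coordinate projections on $\mathbb{D}^2$. $\partial\mathbb{D}^2$ is the topological boundary of $\mathbb{D}^2$. $\mathcal{S}_2$ is the set of holomorphic functions on $\mathbb{D}^2$ bounded by $1$ in modulus; for $\phi\in\mathcal{S}_2$, $\widetilde\phi(\lambda^1,\lambda^2)=\phi(\lambda^2,\lambda^1)$. Models. A model $(\mathcal{M},u)$ for $\phi\in\mathcal{S}_2$ consists of a separable Hilbert space with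 orthogonal decomposition $\mathcal{M}=\mathcal{M}^1\oplus\mathcal{M}^2$ and a holomorphic map $u:\mathbb{D}^2\to\mathcal{M}$, $\lambda\mapsto u_\lambda$, such that for all $\lambda,\mu\in\mathbb{D}^2$, $1-\phi(\lambda)\overline{\phi(\mu)}=(1-\lambda^1\overline{\mu^1})\langle u^1_\lambda,u^1_\mu\rangle+(1-\lambda^2\overline{\mu^2})\langle u^2_\lambda,u^2_\mu\rangle$, where $v^j$ is the orthogonal projection of $v\in\mathcal{M}$ onto $\mathcal{M}^j$. Every $\phi\in\mathcal{S}_2$ has a model. Boundary points. A set $S\subset\mathbb{D}^2$ approaches $\tau\in\partial\mathbb{D}^2$ nontangentially if $\tau\in\mathrm{cl}(S)$ and there is $c>0$ with $\|\tau-\lambda\|\le c(1-\|\lambda\|)$ for all $\lambda\in S$. $\tau\in\partial\mathbb{D}^2$ is a B-point for $\phi$ if $\liminf_{\lambda\to\tau}\frac{1-|\phi(\lambda)|}{1-\|\lambda\|}<\infty$; then the nontangential limit of $\phi$ at $\tau$ exists and is denoted $\phi(\tau)$. A B-point $\tau$ is a C-point if $\phi$ has an angular gradient at $\tau$, i.e. there is $\eta\in\mathbb{C}^2$ with $\phi(\lambda)=\phi(\tau)+\eta^1(\lambda^1-\tau^1)+\eta^2(\lambda^2-\tau^2)+o(\|\lambda-\tau\|)$ as $\lambda\to\tau$ nontangentially. For a B-point $\tau$, $Y_\tau$ is the set of weak limits in $\mathcal{M}$ of weakly convergent sequences $\{u_{\lambda_n}\}$, over sequences $\lambda_n\to\tau$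 in $\mathbb{D}^2$ for which $\frac{1-|\phi(\lambda_n)|}{1-\|\lambda_n\|}$ stays bounded. Let $\mathbb{H}(\tau)$ be $\tau^1\mathbb{H}\times\tau^2\mathbb{H}$ if $\tau\in\mathbb{T}^2$, $\tau^1\mathbb{H}\times\mathbb{C}$ if $\tau\in\mathbb{T}\times\mathbb{D}$, and $\mathbb{C}\times\tau^2\mathbb{H}$ if $\tau\in\mathbb{D}\times\mathbb{T}$. For a B-point $\tau$ and $\delta\in\mathbb{H}(\tau)$ the directional derivative $D_{-\delta}\phi(\tau)=\lim_{t\to0+}\frac{\phi(\tau-t\delta)-\phi(\tau)}{t}$ exists. DW points. Let $\phi\in\mathcal{S}_2$, $\phi\ne\pi^1$, with model $(\mathcal{M},u)$. A point $(\tau^1,\sigma)\in\mathbb{T}\times\mathrm{cl}(\mathbb{D})$ is a left Type I DW point for $\phi$ if it is a B-point, $\phi(\tau^1,\sigma)=\tau^1$, and there exists $v\in Y_{(\tau^1,\sigma)}$ with $\|v^1\|\le1$ and $v^2=0$. A point $\tau=(\tau^1,\tau^2)\in\mathbb{T}^2$ is a left Type II DW point for $\phi$ if it is a B-point, $\phi(\tau)=\tau^1$, there exists $u_\tau\in Y_\tau$ with $\|u^1_\tau\|<1$, and $\tau$ is not a left Type I DW point for $\phi$. If $\phi\ne\pi^2$, a point $(\sigma,\tau^2)\in\mathrm{cl}(\mathbb{D})\times\mathbb{T}$ is a right Type I DW point for $\phi$ if $(\tau^2,\sigma)$ is a left Type I DW point for $\widetilde\phi$, and $(\tau^1,\tau^2)\in\mathbb{T}^2$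 is a right Type II DW point for $\phi$ if $(\tau^2,\tau^1)$ is a left Type II DW point for $\widetilde\phi$. (These notions do not depend on the choice of model.) *)

(* Defs.v *)
From HB Require Import structures.
From mathcomp Require Import all_boot all_order all_algebra.
From mathcomp Require Import complex.
From mathcomp Require Import all_classical all_reals all_analysis.

Set Implicit Arguments.
Unset Strict Implicit.
Unset Printing Implicit Defensive.

Import Order.TTheory GRing.Theory Num.Theory numFieldNormedType.Exports.

Local Open Scope classical_set_scope.
Local Open Scope ring_scope.
Local Open Scope complex_scope.

(* R[i] carries its topology and norm as a normed module over itself, hence
   through the alias R[i]^o.  Norms take values in R[i], and the order of R[i]
   only relates numbers with equal imaginary parts: a < 1 says in particular
   that a is real.  The norm of the product Cx R * Cx R is the maximum of the
   norms of the coordinates. *)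
Notation Cx R := (R[i]^o).
Notation Cx2 R := (R[i]^o * R[i]^o)%type.

Section bidisk.
Variable R : realType.
Local Notation C := (Cx R).
Local Notation C2 := (Cx2 R).

Definition disk : set C := [set z | `|z| < 1].
Definition circle : set C := [set z | `|z| = 1].
Definition bidisk : set C2 := disk `*` disk.
Definition bidisk_bd : set C2 := closure bidisk `\` interior bidisk.

(* Functions on the bidisk are represented by total functions on C2 whose
   values outside the bidisk are irrelevant.  [differentiable] is Frechet
   differentiability over the complex scalars. *)
Definition holomorphic_on_bidisk (W : normedModType R[i]) (f : C2 -> W) :=
  forall l, bidisk l -> differentiable f l.

Definition schur_class (phi : C2 -> C) :=
  holomorphic_on_bidisk phi /\ forall l, bidisk l -> `|phi l| <= 1.

Definition swap_args (phi : C2 -> C) : C2 -> C := fun l => phi (l.2, l.1).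

Definition approaches_nontangentially (S : set C2) (tau : C2) :=
  [/\ S `<=` bidisk, closure S tau &
      exists2 c : R, 0 < c & forall l, S l -> `|tau - l| <= c%:C * (1 - `|l|)].

(* A function tends to a limit along this filter iff it tends to it along
   every set approaching tau nontangentially. *)
Definition nontangential (tau : C2) : set_system C2 :=
  [set A | forall S, approaches_nontangentially S tau -> within S (nbhs tau) A].

Global Instance nontangential_filter (tau : C2) : Filter (nontangential tau).
Proof.
split.
- by move=> S _; exact: filterT.
- by move=> A B hA hB S hS; apply: filterI; [exact: hA | exact: hB].
- by move=> A B AB hA S hS; apply: filterS AB (hA S hS).
Qed.

Canonical nontangential_filter_on (tau : C2) :=
  FilterType (nontangential tau) (nontangential_filter tau).

(* (1 - |phi l|) / (1 - ||l||) is a real number, viewed as an element of R. *)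
Definition caratheodory_quotient (phi : C2 -> C) (l : C2) : R :=
  complex.Re ((1 - `|phi l|) / (1 - `|l|)).

Definition is_Bpoint (phi : C2 -> C) (tau : C2) :=
  bidisk_bd tau /\
  (limf_einf (fun l => (caratheodory_quotient phi l)%:E)
     (within bidisk (nbhs tau)) < +oo)%E.

Definition boundary_value (phi : C2 -> C) (tau : C2) : C :=
  lim (phi @ nontangential tau).

Definition is_Cpoint (phi : C2 -> C) (tau : C2) :=
  is_Bpoint phi tau /\
  let F := nontangential tau in
  exists eta : C2,
    (fun l : C2 => phi l - boundary_value phi tau
       - eta.1 * (l.1 - tau.1) - eta.2 * (l.2 - tau.2) : C)
    =o_F (fun l : C2 => l - tau).

Definition directional_derivative (phi : C2 -> C) (tau d : C2) : C :=
  lim ((t%:C)^-1 *: (phi (tau + t%:C *: d) - boundary_value phi tau)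
       @[t --> (0 : R)^'+]).

Definition left_K (phi : C2 -> C) (tau : C2) (M : R) : R[i] :=
  directional_derivative phi tau (- (tau.1, tau.2 * M%:C)) /
  - boundary_value phi tau.

Definition right_K (phi : C2 -> C) (tau : C2) (M : R) : R[i] :=
  directional_derivative phi tau (- (tau.1 * M%:C, tau.2)) /
  - boundary_value phi tau.

End bidisk.

(* [inner] is linear in its first argument. *)
Record hilbertType (R : realType) := Hilbert {
  hilbert_sort :> completeNormedModType R[i];
  inner : {dot hilbert_sort for (@Num.conj R[i])};
  norm_inner : forall x : hilbert_sort, `|x| ^+ 2 = inner x x
}.

Section hilbert.
Variables (R : realType) (H : hilbertType R).

Definition separable := exists A : set H, countable A /\ dense A.

Definition closed_subspace (E : set H) :=
  [/\ E 0, forall (a : R[i]) x y, E x -> E y -> E (a *: x + y) & closed E].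

Definition orthogonal_decomposition (E1 E2 : set H) :=
  [/\ closed_subspace E1, closed_subspace E2,
      forall x y, E1 x -> E2 y -> inner H x y = 0 &
      forall x, exists x1 x2, [/\ E1 x1, E2 x2 & x = x1 + x2]].

Definition orthogonal_projection (E : set H) (x : H) : H :=
  xget 0 [set y | E y /\ forall z, E z -> inner H (x - y) z = 0].

Definition weakly_converges (x : nat -> H) (v : H) :=
  forall w : H, (inner H (x n) w : Cx R) @[n --> \oo] --> (inner H v w : Cx R).

End hilbert.

Record model (R : realType) (phi : Cx2 R -> Cx R) := Model {
  model_space : hilbertType R;
  model_separable : separable model_space;
  model_space1 : set model_space;
  model_space2 : set model_space;
  model_decomposition : orthogonal_decomposition model_space1 model_space2;
  model_map : Cx2 R -> model_space;
  model_holomorphic : holomorphic_on_bidisk model_map;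
  model_eq : forall l k : Cx2 R, bidisk l -> bidisk k ->
    1 - phi l * (phi k)^* =
      (1 - l.1 * k.1^*) *
        inner model_space (orthogonal_projection model_space1 (model_map l))
                          (orthogonal_projection model_space1 (model_map k)) +
      (1 - l.2 * k.2^*) *
        inner model_space (orthogonal_projection model_space2 (model_map l))
                          (orthogonal_projection model_space2 (model_map k))
}.
Arguments model_space1 {R phi} m _.
Arguments model_space2 {R phi} m _.
Arguments model_map {R phi} m _.

Section DW.
Variables (R : realType).
Local Notation C := (Cx R).
Local Notation C2 := (Cx2 R).

Definition comp1 (phi : C2 -> C) (Mu : model phi) (v : model_space Mu) :=
  orthogonal_projection (model_space1 Mu) v.
Definition comp2 (phi : C2 -> C) (Mu : model phi) (v : model_space Mu) :=
  orthogonal_projection (model_space2 Mu) v.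

Definition weak_limits (phi : C2 -> C) (Mu : model phi) (tau : C2) :
    set (model_space Mu) :=
  [set v | exists l : nat -> C2,
     [/\ forall n, bidisk (l n), l @ \oo --> tau,
         bounded_fun (fun n => caratheodory_quotient phi (l n)) &
         weakly_converges (fun n => model_map Mu (l n)) v]].

Arguments weak_limits {phi} Mu tau _.

Definition left_typeI (phi : C2 -> C) (Mu : model phi) (tau : C2) :=
  [/\ circle tau.1, closure (@disk R) tau.2, is_Bpoint phi tau,
      boundary_value phi tau = tau.1 &
      exists2 v, weak_limits Mu tau v & `|comp1 v| <= 1 /\ comp2 v = 0].

Definition left_typeII (phi : C2 -> C) (Mu : model phi) (tau : C2) :=
  [/\ circle tau.1 /\ circle tau.2, is_Bpoint phi tau,
      boundary_value phi tau = tau.1,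
      exists2 v, weak_limits Mu tau v & `|comp1 v| < 1 &
      ~ left_typeI Mu tau].

Definition right_typeI (phi : C2 -> C) (Mu : model (swap_args phi)) (tau : C2) :=
  left_typeI Mu (tau.2, tau.1).

Definition right_typeII (phi : C2 -> C) (Mu : model (swap_args phi)) (tau : C2) :=
  left_typeII Mu (tau.2, tau.1).

End DW.

(* Main.v *)
Require Import Defs.
From HB Require Import structures.
From mathcomp Require Import all_boot all_order all_algebra.
From mathcomp Require Import complex.
From mathcomp Require Import all_classical all_reals all_analysis.
From mathcomp Require Import ring lra.

Set Implicit Arguments.
Unset Strict Implicit.
Unset Printing Implicit Defensive.
Import Order.TTheory GRing.Theory Num.Theory numFieldNormedType.Exports.
Local Open Scope classical_set_scope.
Local Open Scope ring_scope.
Local Open Scope complex_scope.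

(** Write [u] for the model, [u1], [u2] for its components, and [K M] for
    [left_K phi tau M].  The model equation expresses [1 - phi l * conj (phi k)]
    through inner products of [u l] and [u k]; the whole argument is geometry of
    Hilbert space applied to this identity at two points.

    Call a filter tame if it converges to [tau] while the Caratheodory quotient
    stays bounded.  Along a tame filter [u] is bounded, so for two tame filters
    the right-hand side of the model equation tends to 0.  Hence [phi] has the
    same unimodular limit along all tame filters ([tame_limit]), and sets that
    approach [tau] nontangentially are tame by the Cauchy-Schwarz inequality
    against any one tame filter ([nontangential_tame]).

    Fix a direction [(tau.1, tau.2 * M)] and weight the second coordinate of the
    Hilbert space by [M].  Along the ray in this direction the difference
    quotient of [phi] is the limit of weighted inner products of [u]; expanding
    |u_t - u_s|^2 shows that [u] converges in norm ([curve_limit]) to a vector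
    w_M with K M = |w_M|_M^2, and <w_M, v>_M = K M for every weak limit [v] of
    [u] along a tame filter ([direction_limit], [wip_limit]).  Therefore
    |v - w_M|_M^2 = |v|_M^2 - K M: the number K M is the minimum of
    |v1|^2 + M |v2|^2 over all such [v], attained at w_M.  In particular [K] is
    nonnegative, nondecreasing and concave, and it is constant as soon as some
    w_M has no second component ([wsq_constant]).

    The classification follows.  A Type I vector bounds [K] by 1; conversely,
    if [K <= 1] then w_M has a limit as M tends to infinity, and this limit is a
    Type I vector ([typeI_of_K_le1]).  If moreover K M = 1 for some M then
    minimality forces w_M to coincide with the Type I vector, so that [K] is
    constant ([typeI_strict]).  An angular gradient makes [K] affine, hence
    constant when it is bounded; when [K] is constant the second components
    vanish and the model equation with one point moved to the boundary exhibits
    the gradient ([Cpoint_of_direction]).  A Type II vector makes [K] smaller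
    than 1 near 0, and the intermediate value theorem yields the value 1
    ([typeIIP]).  If [tau.2] lies inside the disk, the second component of every
    limit is 0 and [K] is always constant.  The statements for right points are
    those for left points after exchanging the two coordinates. *)

(** * Real-valued moduli *)

(** Norms over [R[i]] are complex numbers whose order is partial; working with
    their real parts keeps all estimates inside the ordered field [R].  The lock
    keeps arithmetic tactics from comparing moduli by unfolding. *)
HB.lock Definition nrm (R : realType) (V : normedModType R[i]) (x : V) : R :=
  complex.Re `|x|.

Section ComplexModulus.
Variable R : realType.
Implicit Types (V : normedModType R[i]) (z w : Cx R).

Lemma nrmE V (x : V) : `|x| = (nrm x)%:C.
Proof. by rewrite nrm.unlock RRe_real // ger0_real. Qed.

Lemma nrm_ge0 V (x : V) : 0 <= nrm x.
Proof. by rewrite -ler0c -nrmE normr_ge0. Qed.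

Lemma nrm0 V : nrm (0 : V) = 0.
Proof. by apply: complexI; rewrite -nrmE normr0. Qed.

Lemma nrm_eq0 V (x : V) : nrm x = 0 -> x = 0.
Proof. by move=> x0; apply: normr0_eq0; rewrite nrmE x0. Qed.

Lemma nrmN V (x : V) : nrm (- x) = nrm x.
Proof. by rewrite nrm.unlock normrN. Qed.

Lemma nrmBC V (x y : V) : nrm (x - y) = nrm (y - x).
Proof. by rewrite nrm.unlock distrC. Qed.

Lemma ler_nrmD V (x y : V) : nrm (x + y) <= nrm x + nrm y.
Proof. rewrite -lecR rmorphD /= -!nrmE; exact: ler_normD. Qed.

Lemma ler_nrmB V (x y : V) : nrm (x - y) <= nrm x + nrm y.
Proof. by rewrite -[nrm y]nrmN ler_nrmD. Qed.

Lemma nrmM z w : nrm (z * w : Cx R) = nrm z * nrm w.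
Proof. by apply: complexI; rewrite rmorphM /= -!nrmE normrM. Qed.

Lemma nrmZ V z (x : V) : nrm (z *: x) = nrm z * nrm x.
Proof. by apply: complexI; rewrite rmorphM /= -!nrmE normrZ. Qed.

Lemma nrmJ z : nrm (conjc z : Cx R) = nrm z.
Proof. by apply: complexI; rewrite -!nrmE normcJ. Qed.

Lemma nrm_real (a : R) : nrm (a%:C : Cx R) = `|a|.
Proof.
by apply: complexI; rewrite -nrmE normc_def /= expr0n addr0 sqrtr_sqr.
Qed.

Lemma nrm1 : nrm (1 : Cx R) = 1.
Proof. by apply: complexI; rewrite -nrmE normr1. Qed.

Lemma Re_le_nrm z : `|complex.Re z| <= nrm z.
Proof. by rewrite -lecR -nrmE normc_ge_Re. Qed.

Lemma Im_le_nrm z : `|complex.Im z| <= nrm z.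
Proof.
have := Re_le_nrm (z * 'i%C); rewrite ReiNIm normrN nrmM.
by have -> : nrm ('i%C : Cx R) = 1;
  [apply: complexI; rewrite -nrmE normc_def /= expr0n add0r expr1n sqrtr1
  |rewrite mulr1].
Qed.

Lemma nrm_le_ReIm z : nrm z <= `|complex.Re z| + `|complex.Im z|.
Proof.
rewrite {1}(complexE z) (le_trans (ler_nrmD _ _))// nrmM !nrm_real lerD2l.
by have -> : nrm ('i%C : Cx R) = 1;
  [apply: complexI; rewrite -nrmE normc_def /= expr0n add0r expr1n sqrtr1
  |rewrite mul1r].
Qed.

Lemma mulcJ z : z * conjc z = (nrm z ^+ 2)%:C.
Proof. by rewrite -sqr_normc (nrmE z : Num.norm (z : R[i]) = _) rmorphXn. Qed.

Lemma nrm_pair V1 V2 (x : V1 * V2) : nrm x = Num.max (nrm x.1) (nrm x.2).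
Proof.
apply: complexI; rewrite -nrmE; have -> : `|x| = Num.max `|x.1| `|x.2| by [].
rewrite !nrmE; case: (leP (nrm x.1) (nrm x.2)) => h.
- by rewrite max_r // lecR.
- by rewrite max_l // lecR ltW.
Qed.

Lemma cvg_nrmP V T (F : set_system T) {FF : Filter F} (f : T -> V) (l : V) :
  f @ F --> l <-> (forall e : R, 0 < e -> \forall t \near F, nrm (f t - l) < e).
Proof.
split=> [/cvgrPdist_lt fl e e0|fl].
- have /fl : (0 : R[i]) < e%:C by rewrite ltcR.
  by apply: filterS => t; rewrite nrmE ltcR nrmBC.
- apply/cvgrPdist_lt => e e0.
  have er : e = (complex.Re e)%:C by rewrite RRe_real // ger0_real // ltW.
  have /fl : 0 < complex.Re e by rewrite -ltcR -er.
  by apply: filterS => t; rewrite nrmE er ltcR nrmBC.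
Qed.

Lemma cvg_nrm0P V T (F : set_system T) {FF : Filter F} (f : T -> V) (l : V) :
  f @ F --> l <-> (fun t => nrm (f t - l)) @ F --> (0 : R).
Proof.
rewrite cvg_nrmP; split => [fl|/cvgr0Pnorm_lt fl e /fl].
- apply/cvgr0Pnorm_lt => e /fl.
  by apply: filterS => t; rewrite ger0_norm // nrm_ge0.
- by apply: filterS => t; rewrite ger0_norm // nrm_ge0.
Qed.

Lemma cvg_nrm_le V T (F : set_system T) {FF : Filter F} (f : T -> V) (l : V)
    (g : T -> R) :
  (\forall t \near F, nrm (f t - l) <= g t) -> g @ F --> 0 -> f @ F --> l.
Proof.
move=> fg g0; apply/cvg_nrm0P.
apply: (squeeze_cvgr (f := cst 0) (h := g)) => //; last exact: cvg_cst.
by apply: filterS fg => t ->; rewrite nrm_ge0.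
Qed.

Lemma ler_dist_nrm V (x y : V) : `|nrm x - nrm y| <= nrm (x - y).
Proof.
rewrite ler_norml; apply/andP; split.
- rewrite lerNl opprB lerBlDr nrmBC -{1}(subrK x y); exact: ler_nrmD.
- rewrite lerBlDr -{1}(subrK y x); exact: ler_nrmD.
Qed.

Lemma cvg_nrm V T (F : set_system T) {FF : Filter F} (f : T -> V) (l : V) :
  f @ F --> l -> (fun t => nrm (f t)) @ F --> nrm l.
Proof.
move=> /cvg_nrmP fl; apply/cvgrPdist_lt => e /fl.
by apply: filterS => t; apply: le_lt_trans; rewrite distrC ler_dist_nrm.
Qed.

Lemma cvg_Re T (F : set_system T) {FF : Filter F} (f : T -> Cx R) (l : Cx R) :
  f @ F --> l -> (fun t => complex.Re (f t)) @ F --> complex.Re l.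
Proof.
move=> /cvg_nrmP fl; apply/cvgrPdist_lt => e /fl.
apply: filterS => t; apply: le_lt_trans; rewrite distrC.
by rewrite (le_trans _ (Re_le_nrm _)) // raddfB.
Qed.

Lemma cvg_conj T (F : set_system T) {FF : Filter F} (f : T -> Cx R) (l : Cx R) :
  f @ F --> l -> (fun t => conjc (f t) : Cx R) @ F --> (conjc l : Cx R).
Proof.
move=> /cvg_nrmP fl; apply/cvg_nrmP => e /fl.
by apply: filterS => t; rewrite -rmorphB nrmJ.
Qed.

Lemma cvg_mulC T (F : set_system T) {FF : Filter F} (f g : T -> Cx R) (a b : Cx R) :
  f @ F --> a -> g @ F --> b -> (fun t => f t * g t : Cx R) @ F --> (a * b : Cx R).
Proof. by move=> fa gb; exact: (@cvgZ _ (Cx R) _ F FF f g a b fa gb). Qed.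

Lemma cvg_nrm_unique V T (F : set_system T) {FF : ProperFilter F} (f : T -> V) (a b : V) :
  f @ F --> a -> f @ F --> b -> a = b.
Proof. exact: (cvg_unique (@norm_hausdorff _ V)). Qed.

(** The scalars are complete because the reals are, coordinate by coordinate. *)
Lemma complex_cauchy T (F : set_system T) {FF : ProperFilter F} (f : T -> Cx R) :
  (forall e : R, 0 < e -> exists l : Cx R, \forall t \near F, nrm (f t - l) < e) ->
  exists l : Cx R, f @ F --> l.
Proof.
move=> fc.
have aux (p : Cx R -> R) : (forall z w, `|p z - p w| <= nrm (z - w)) ->
    exists a : R, (fun t => p (f t)) @ F --> a.
  move=> pB; suff /cauchy_cvgP ? : cauchy ((fun t => p (f t)) @ F).
    by exists (lim ((fun t => p (f t)) @ F)).
  apply: cauchy_exP => e /fc[l fl]; exists (p l).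
  by apply: filterS fl => t; apply: le_lt_trans; rewrite distrC.
have [a fa] := aux (@complex.Re R) (fun z w => ltac:(rewrite -raddfB; exact: Re_le_nrm)).
have [b fb] := aux (@complex.Im R) (fun z w => ltac:(rewrite -raddfB; exact: Im_le_nrm)).
exists (Complex a b); apply/cvg_nrmP => e e0.
have e2 : 0 < e / 2 by rewrite divr_gt0.
move: fa fb => /cvgrPdist_lt/(_ _ e2) fa /cvgrPdist_lt/(_ _ e2) fb.
near=> t; apply: le_lt_trans (nrm_le_ReIm _) _; rewrite !raddfB /=.
by rewrite [ltRHS]splitr ltrD // distrC; near: t.
Unshelve. all: by end_near. Qed.

End ComplexModulus.

(** * Hilbert spaces and orthogonal decompositions *)
Section Hilbert.
Variables (R : realType) (H : hilbertType R).
Local Notation C := (Cx R).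
Implicit Types (x y z : H).

Definition ip x y : C := inner H x y.

Lemma ipDl x y z : ip (x + y) z = ip x z + ip y z.
Proof. exact: linearDl. Qed.
Lemma ipBl x y z : ip (x - y) z = ip x z - ip y z.
Proof. exact: linearBl. Qed.
Lemma ipDr x y z : ip x (y + z) = ip x y + ip x z.
Proof. exact: linearDr. Qed.
Lemma ipBr x y z : ip x (y - z) = ip x y - ip x z.
Proof. exact: linearBr. Qed.
Lemma ipZl (a : C) x y : ip (a *: x) y = a * ip x y.
Proof. exact: linearZl_LR. Qed.
Lemma ipC x y : ip y x = conjc (ip x y).
Proof. by rewrite /ip hermC expr0 mul1r. Qed.
Lemma ipZr (a : C) x y : ip x (a *: y) = conjc a * ip x y.
Proof. by rewrite ipC ipZl rmorphM /= -ipC. Qed.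
Lemma ipxx x : ip x x = (nrm x ^+ 2)%:C.
Proof. by rewrite /ip -norm_inner nrmE rmorphXn. Qed.
Lemma ip0l x : ip 0 x = 0.
Proof. exact: linear0l. Qed.
Lemma ip0r x : ip x 0 = 0.
Proof. exact: linear0r. Qed.

Lemma nrmB_sqr x y :
  nrm (x - y) ^+ 2 = nrm x ^+ 2 + nrm y ^+ 2 - 2 * complex.Re (ip x y).
Proof.
apply: complexI; rewrite -ipxx ipBl !ipBr !ipxx (ipC x y).
rewrite rmorphB rmorphD (rmorphM _ 2) /= (ReJ_add (ip x y)).
have -> : (2%:C : R[i]) = 2 by rewrite rmorph_nat.
by field.
Qed.

(** Expand |x - a y|^2 >= 0 for the coefficient a = <x, y> / |y|^2 of the
    projection of [x] on the line of [y]. *)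
Lemma CauchySchwarz_ip x y : nrm (ip x y) <= nrm x * nrm y.
Proof.
have [y0|y0] := eqVneq (nrm y) 0.
  by rewrite (nrm_eq0 y0) ip0r !nrm0 mulr0.
have yp : 0 < nrm y by rewrite lt_def y0 nrm_ge0.
set z := ip x y; pose a : C := z * ((nrm y ^+ 2)^-1)%:C.
have := sqr_ge0 (nrm (x - a *: y)); rewrite nrmB_sqr nrmZ ipZr -/z.
have -> : conjc a * z = (nrm z ^+ 2 / nrm y ^+ 2)%:C.
  have -> : conjc a = conjc z * ((nrm y ^+ 2)^-1)%:C.
    by rewrite /a rmorphM; congr (_ * _); exact: conjc_real.
  by rewrite mulrAC [_ * z]mulrC mulcJ -rmorphM.
have -> : nrm a = nrm z / nrm y ^+ 2.
  by rewrite nrmM nrm_real ger0_norm // invr_ge0 sqr_ge0.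
rewrite /= => h; rewrite -(@ler_pXn2r _ 2) ?nnegrE ?mulr_ge0 ?nrm_ge0//.
have -> : nrm z ^+ 2 = nrm z ^+ 2 / nrm y ^+ 2 * nrm y ^+ 2.
  by rewrite divfK // expf_neq0.
rewrite exprMn ler_pM2r ?exprn_gt0 // -subr_ge0; apply: le_trans h _.
by rewrite le_eqVlt; apply/orP; left; apply/eqP; field.
Qed.

Lemma hilbert_cauchy T (F : set_system T) {FF : ProperFilter F} (f : T -> H) :
  (forall e : R, 0 < e -> exists l : H, \forall t \near F, nrm (f t - l) < e) ->
  exists l : H, f @ F --> l.
Proof.
move=> fc; suff /cauchy_cvgP ? : cauchy (f @ F) by exists (lim (f @ F)).
apply: cauchy_exP => e e0.
have er : e = (complex.Re e)%:C by rewrite RRe_real // ger0_real // ltW.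
have /fc[l fl] : 0 < complex.Re e by rewrite -ltcR -er.
exists l; apply: filterS fl => t.
by rewrite -ball_normE /ball_ /= nrmE er ltcR nrmBC.
Qed.

Section Projections.
Variables E1 E2 : set H.
Hypothesis E12 : orthogonal_decomposition E1 E2.

Lemma orthogonal_decomposition_sym : orthogonal_decomposition E2 E1.
Proof.
have [c1 c2 o d] := E12; split=> // [x y ex ey|x].
- by rewrite -/(ip _ _) ipC [ip _ _]o // conjc0.
- by have [x1 [x2 [? ? ->]]] := d x; exists x2, x1; rewrite addrC.
Qed.

(** A decomposition of [x] along the two subspaces determines the projection,
    which the definition only describes by orthogonality of the remainder. *)
Lemma projection_unique x x1 x2 :
  E1 x1 -> E2 x2 -> x = x1 + x2 -> orthogonal_projection E1 x = x1.
Proof.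
have [[_ l1 _] c2 o d] := E12 => e1 e2 ->; rewrite /orthogonal_projection.
apply: xget_unique => [|y [ey oy]].
- by split=> // z ez; rewrite addrC addKr -/(ip _ _) ipC [ip _ _]o // conjc0.
- have ez : E1 (y - x1) by rewrite -scaleN1r addrC; apply: l1.
  have := oy _ ez; rewrite -/(ip _ _) (_ : _ - y = x2 - (y - x1)); last first.
    by rewrite opprB addrA [x2 + x1]addrC.
  rewrite ipBl ipC [ip (y - x1) x2]o // conjc0 sub0r => /eqP.
  rewrite oppr_eq0 ipxx => /eqP/complexI/eqP; rewrite expf_eq0 /= => /eqP.
  by move=> /nrm_eq0/eqP; rewrite subr_eq0 => /eqP.
Qed.

End Projections.

Section Decomposition.
Variables E1 E2 : set H.
Hypothesis E12 : orthogonal_decomposition E1 E2.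
Local Notation P1 := (orthogonal_projection E1).
Local Notation P2 := (orthogonal_projection E2).

Lemma projectionP x : [/\ E1 (P1 x), E2 (P2 x) & x = P1 x + P2 x].
Proof.
have [_ _ _ /(_ x)[x1 [x2 [e1 e2 xE]]]] := E12.
rewrite (projection_unique E12 e1 e2 xE).
by rewrite (projection_unique (orthogonal_decomposition_sym E12) e2 e1) // addrC.
Qed.

Lemma projectionB x y : P1 (x - y) = P1 x - P1 y.
Proof.
have [[_ l1 _] [_ l2 _] _ _] := E12.
have [x1 x2 xE] := projectionP x; have [y1 y2 yE] := projectionP y.
apply: (projection_unique E12 (x2 := P2 x - P2 y)).
- by rewrite addrC -scaleN1r; apply: l1.
- by rewrite addrC -scaleN1r; apply: l2.
- by rewrite {1}xE {1}yE opprD addrACA.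
Qed.

Lemma ip_projection x y : ip (P1 x) y = ip x (P1 y).
Proof.
have [_ _ o _] := E12.
have [x1 x2 xE] := projectionP x; have [y1 y2 yE] := projectionP y.
rewrite {1}yE {2}xE ipDr ipDl [ip (P1 x) (P2 y)]o // addr0.
by rewrite [ip (P2 x) _]ipC [ip _ (P2 x)]o // conjc0 addr0.
Qed.

Lemma nrm_projection_sqr x : nrm x ^+ 2 = nrm (P1 x) ^+ 2 + nrm (P2 x) ^+ 2.
Proof.
have [_ _ o _] := E12; have [x1 x2 xE] := projectionP x.
apply: complexI; rewrite rmorphD /= -!ipxx {1 2}xE ipDl !ipDr.
rewrite [ip (P1 x) (P2 x)]o // [ip (P2 x) (P1 x)]ipC [ip (P1 x) (P2 x)]o //.
by rewrite conjc0 addr0 add0r.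
Qed.

Lemma nrm_projection_le x : nrm (P1 x) <= nrm x.
Proof.
rewrite -(@ler_pXn2r _ 2) ?nnegrE ?nrm_ge0// (nrm_projection_sqr x).
by rewrite lerDl sqr_ge0.
Qed.

Lemma cvg_projection T (F : set_system T) {FF : Filter F} (f : T -> H) l :
  f @ F --> l -> (fun t => P1 (f t)) @ F --> P1 l.
Proof.
move=> /cvg_nrmP fl; apply/cvg_nrmP => e /fl.
by apply: filterS => t; apply: le_lt_trans; rewrite -projectionB nrm_projection_le.
Qed.

End Decomposition.
End Hilbert.

(** * Limits along filters *)
Section FilterLemmas.
Variable R : realType.
Local Notation C := (Cx R).

Lemma cvg_bounded_mul0 T (F : set_system T) {FF : Filter F} (f g : T -> C) (B : R) :
  (\forall t \near F, nrm (f t) <= B) -> g @ F --> (0 : C) ->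
  (fun t => f t * g t : C) @ F --> (0 : C).
Proof.
move=> fB g0; apply: (@cvg_nrm_le _ _ _ _ _ _ _ (fun t => B * nrm (g t))).
  by apply: filterS fB => t tB; rewrite subr0 nrmM ler_wpM2r // nrm_ge0.
rewrite -[X in _ --> X](mulr0 B); apply: cvgM; first exact: cvg_cst.
by rewrite -[X in _ --> X](@nrm0 R C); apply: cvg_nrm.
Qed.

(** A bounded function that asymptotically dominates each of its own values,
    up to a vanishing error, has its limes superior as a limit. *)
Lemma cvg_almost_nondecreasing T (F : set_system T) {FF : ProperFilter F}
    (f c : T -> R) (B : R) :
  (\forall t \near F, 0 <= f t <= B) -> c @ F --> 0 ->
  (\forall t \near F, forall e, 0 < e -> \forall s \near F, f t - c t - e <= f s) ->
  exists l : R, f @ F --> l.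
Proof.
move=> fB c0 ft.
pose E := [set y | \forall t \near F, f t <= y].
have EB : E B by apply: filterS fB => t /andP[].
have E0 : lbound E 0.
  move=> y /(filterI fB) /filter_ex[t [/andP[f0 _]]]; exact: le_trans.
have Einf : has_inf E by split; [exists B | exists 0].
exists (inf E); apply/cvgrPdist_le => e e0.
have e3 : 0 < e / 3 by rewrite divr_gt0.
have up : \forall t \near F, f t <= inf E + e.
  have [y Ey yle] := inf_adherent e0 Einf.
  by apply: filterS Ey => t /le_trans; apply; exact: ltW.
have [t [tf /andP[tc tb]]] : exists t,
    (forall e, 0 < e -> \forall s \near F, f t - c t - e <= f s) /\
    (c t <= e / 3) && (inf E - e / 3 < f t).
  apply: contrapT => no.
  have : E (inf E - e / 3).
    move/cvgrPdist_le : c0 => /(_ _ e3) c0.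
    near=> t; rewrite leNgt; apply/negP => tb; apply: no; exists t; split.
      by near: t.
    rewrite tb andbT; apply: le_trans (ler_norm _) _.
    by rewrite -normrN -[- c t]add0r; near: t.
  move=> /(ge_inf Einf.2); rewrite leNgt => /negP; apply.
  by rewrite ltrBlDr ltrDl.
have low := tf _ e3.
near=> s; rewrite ler_norml.
have : f s <= inf E + e by near: s.
have : f t - c t - e / 3 <= f s by near: s.
lra.
Unshelve. all: by end_near. Qed.

End FilterLemmas.

(** * The model along tame filters *)
Section Model.
Variables (R : realType) (phi : Cx2 R -> Cx R) (Mu : model phi).
Local Notation C := (Cx R).
Local Notation C2 := (Cx2 R).
Local Notation H := (model_space Mu).
Local Notation P1 := (@comp1 R phi Mu).
Local Notation P2 := (@comp2 R phi Mu).
Local Notation u := (model_map Mu).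
Implicit Types (l k : C2) (x y v : H).

Let dec := model_decomposition Mu.
Let dec' := orthogonal_decomposition_sym dec.

Lemma comp1B x y : P1 (x - y) = P1 x - P1 y.
Proof. exact: projectionB dec _ _. Qed.
Lemma comp2B x y : P2 (x - y) = P2 x - P2 y.
Proof. exact: projectionB dec' _ _. Qed.
Lemma ip_comp1 x y : ip (P1 x) y = ip x (P1 y).
Proof. exact: ip_projection dec _ _. Qed.
Lemma ip_comp2 x y : ip (P2 x) y = ip x (P2 y).
Proof. exact: ip_projection dec' _ _. Qed.
Lemma comp1K x : P1 (P1 x) = P1 x.
Proof.
have [e1 _ _] := projectionP dec x; have [_ [z2 _ _] _ _] := dec.
by apply: (projection_unique dec e1 z2); rewrite addr0.
Qed.
Lemma comp2K x : P2 (P2 x) = P2 x.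
Proof.
have [e1 _ _] := projectionP dec' x; have [_ [z2 _ _] _ _] := dec'.
by apply: (projection_unique dec' e1 z2); rewrite addr0.
Qed.
Lemma nrm_comp_sqr x : nrm x ^+ 2 = nrm (P1 x) ^+ 2 + nrm (P2 x) ^+ 2.
Proof. exact: nrm_projection_sqr dec _. Qed.
Lemma nrm_comp1_le x : nrm (P1 x) <= nrm x.
Proof. exact: nrm_projection_le dec _. Qed.
Lemma nrm_comp2_le x : nrm (P2 x) <= nrm x.
Proof. exact: nrm_projection_le dec' _. Qed.
Lemma cvg_comp1 T (F : set_system T) {FF : Filter F} (f : T -> H) v :
  f @ F --> v -> (fun t => P1 (f t)) @ F --> P1 v.
Proof. exact: (cvg_projection dec). Qed.
Lemma cvg_comp2 T (F : set_system T) {FF : Filter F} (f : T -> H) v :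
  f @ F --> v -> (fun t => P2 (f t)) @ F --> P2 v.
Proof. exact: (cvg_projection dec'). Qed.

Lemma bidiskP l : bidisk l <-> nrm l.1 < 1 /\ nrm l.2 < 1.
Proof.
by rewrite /bidisk /disk /setX /= !nrmE -[1 : R[i]]/(1%:C) !ltcR.
Qed.

Lemma bidisk_nrm l : bidisk l <-> nrm l < 1.
Proof.
rewrite bidiskP nrm_pair gt_max; split => [[-> ->]//|/andP[]//].
Qed.

Lemma model_two_point l k : bidisk l -> bidisk k ->
  1 - phi l * conjc (phi k) =
  (1 - l.1 * conjc k.1) * ip (P1 (u l)) (P1 (u k)) +
  (1 - l.2 * conjc k.2) * ip (P2 (u l)) (P2 (u k)) :> C.
Proof. exact: model_eq. Qed.

Lemma model_diagonal l : bidisk l ->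
  1 - nrm (phi l) ^+ 2 = (1 - nrm l.1 ^+ 2) * nrm (P1 (u l)) ^+ 2 +
                         (1 - nrm l.2 ^+ 2) * nrm (P2 (u l)) ^+ 2.
Proof.
move=> dl; have := model_two_point dl dl; rewrite !mulcJ !ipxx -[1]/(1%:C).
by rewrite -!rmorphB -!rmorphM -rmorphD => /complexI.
Qed.

Lemma phi_le1 l : bidisk l -> nrm (phi l) <= 1.
Proof.
move=> dl; rewrite -(@ler_pXn2r _ 2) ?nnegrE ?nrm_ge0// expr1n -subr_ge0.
rewrite model_diagonal //; move/bidiskP : dl => [l1 l2].
have := nrm_ge0 l.1; have := nrm_ge0 l.2 => l20 l10.
by rewrite addr_ge0 // mulr_ge0 ?sqr_ge0 // subr_ge0 expr_le1 // ltW.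
Qed.

Lemma model_two_point_le l k : bidisk l -> bidisk k ->
  nrm (1 - phi l * conjc (phi k) : C) <=
  nrm (1 - l.1 * conjc k.1 : C) * (nrm (P1 (u l)) * nrm (P1 (u k))) +
  nrm (1 - l.2 * conjc k.2 : C) * (nrm (P2 (u l)) * nrm (P2 (u k))).
Proof.
move=> dl dk; rewrite model_two_point // (le_trans (ler_nrmD _ _)) // !nrmM.
by rewrite lerD // ler_wpM2l ?nrm_ge0 // CauchySchwarz_ip.
Qed.

(** Since [phi] is bounded by 1, its defect at one point is controlled by the
    two-point kernel with an arbitrary second point; this is how information at
    a tame filter is carried over to other points. *)
Lemma model_sub_le l k : bidisk l -> bidisk k ->
  1 - nrm (phi l) <= nrm (1 - phi l * conjc (phi k) : C).
Proof.
move=> dl dk; have := ler_dist_nrm (1 : C) (phi l * conjc (phi k)).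
rewrite nrm1 nrmM nrmJ; apply: le_trans; apply: le_trans (ler_norm _).
by rewrite lerD2l lerN2 ler_piMr ?nrm_ge0 // phi_le1.
Qed.

(** Both coefficients on the diagonal of the model equation are at least
    [1 - nrm l], so a bounded Caratheodory quotient bounds the model. *)
Lemma model_bound l : bidisk l ->
  nrm (u l) ^+ 2 * (1 - nrm l) <= 2 * (1 - nrm (phi l)).
Proof.
move=> dl; have p1 := phi_le1 dl; have p0 := nrm_ge0 (phi l).
apply: (@le_trans _ _ (1 - nrm (phi l) ^+ 2)); last by nra.
rewrite model_diagonal // nrm_comp_sqr mulrDl lerD //.
- rewrite mulrC ler_wpM2r ?sqr_ge0 //.
  have : nrm l.1 <= nrm l by rewrite nrm_pair le_max lexx.
  by move/bidiskP : dl => [l1 _]; have := nrm_ge0 l.1; nra.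
- rewrite mulrC ler_wpM2r ?sqr_ge0 //.
  have : nrm l.2 <= nrm l by rewrite nrm_pair le_max lexx orbT.
  by move/bidiskP : dl => [_ l2]; have := nrm_ge0 l.2; nra.
Qed.

Variable tau : C2.
Hypothesis taubd : bidisk_bd tau.

Lemma bidisk_bd_nrm : nrm tau = 1.
Proof.
have [clo nint] := taubd.
apply/eqP; rewrite eq_le; apply/andP; split.
- rewrite leNgt; apply/negP => t1.
  have e0 : 0 < (nrm tau - 1)%:C :> R[i] by rewrite ltcR subr_gt0.
  have [l [/bidisk_nrm l1]] := clo _ (nbhsx_ballx tau _ e0).
  rewrite -ball_normE /ball_ /= nrmE ltcR => tl.
  by have := ler_dist_nrm tau l; rewrite ler_norml; move: tl l1; lra.
- rewrite leNgt; apply/negP => t1; apply: nint.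
  have e0 : 0 < (1 - nrm tau)%:C :> R[i] by rewrite ltcR subr_gt0.
  apply/nbhs_ballP; exists (1 - nrm tau)%:C => //= l.
  rewrite -ball_normE /ball_ /= nrmE ltcR => tl; apply/bidisk_nrm.
  by have := ler_dist_nrm tau l; rewrite ler_norml; move: tl; lra.
Qed.

Lemma bd_le1 : nrm tau.1 <= 1 /\ nrm tau.2 <= 1.
Proof.
by have := bidisk_bd_nrm; rewrite nrm_pair => e; rewrite -{1 2}e !le_max !lexx orbT.
Qed.

(** The filters along which the model stays bounded: those that converge to the
    boundary point while the Caratheodory quotient stays bounded. *)
Definition tame (F : set_system C2) := F --> tau /\
  exists X : R, \forall l \near F, bidisk l /\ 1 - nrm (phi l) <= X * (1 - nrm l).

Lemma tame_model_le l X : bidisk l -> 1 - nrm (phi l) <= X * (1 - nrm l) ->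
  nrm (u l) <= 2 * (1 + X).
Proof.
move=> dl qX; have := model_bound dl; have := phi_le1 dl.
move/bidisk_nrm : dl; rewrite -subr_gt0 => l1 p1 ub.
have X0 : 0 <= X.
  by rewrite -(@pmulr_lge0 _ (1 - nrm l)) //; apply: le_trans qX; rewrite subr_ge0.
have : nrm (u l) ^+ 2 <= 2 * X.
  by rewrite -(ler_pM2r l1) (le_trans ub) // -mulrA ler_pM2l.
by move=> u2; have := nrm_ge0 (u l); nra.
Qed.

Lemma tame_model_bounded F {FF : Filter F} : tame F ->
  exists2 B, 0 <= B & \forall l \near F, bidisk l /\ nrm (u l) <= B.
Proof.
move=> [_ [X FX]]; exists `|2 * (1 + X)| => //.
apply: filterS FX => l [dl /(tame_model_le dl) h]; split=> //.
exact: le_trans h (ler_norm _).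
Qed.

Lemma tame_bidisk F {FF : Filter F} : tame F -> \forall l \near F, bidisk l.
Proof. by move=> [_ [X]]; apply: filterS => l []. Qed.

Lemma tame_cvg1 F {FF : Filter F} : tame F -> (fun l => l.1) @ F --> tau.1.
Proof.
move=> [Ft _]; move: (@cvg_nrmP R _ _ _ FF id tau) => [/(_ Ft) h _].
apply/cvg_nrmP => e /h; apply: filterS => l; apply: le_lt_trans.
by rewrite (nrm_pair (l - tau)) le_max lexx.
Qed.

Lemma tame_cvg2 F {FF : Filter F} : tame F -> (fun l => l.2) @ F --> tau.2.
Proof.
move=> [Ft _]; move: (@cvg_nrmP R _ _ _ FF id tau) => [/(_ Ft) h _].
apply/cvg_nrmP => e /h; apply: filterS => l; apply: le_lt_trans.
by rewrite (nrm_pair (l - tau)) le_max lexx orbT.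
Qed.

Lemma tame_nrm_phi F {FF : Filter F} : tame F -> (fun l => nrm (phi l)) @ F --> (1 : R).
Proof.
move=> [Ft [X FX]].
have tn : (fun l => X * (1 - nrm l)) @ F --> (0 : R).
  rewrite -[X in _ --> X](mulr0 X); apply: cvgM; first exact: cvg_cst.
  rewrite -(subrr 1); apply: cvgB; first exact: cvg_cst.
  by rewrite -bidisk_bd_nrm; apply: (@cvg_nrm R _ _ _ FF id tau).
apply: (@squeeze_cvgr _ _ _ _ (fun l => 1 - X * (1 - nrm l)) (cst 1)).
- apply: filterS FX => l [/phi_le1 -> h]; rewrite andbT; lra.
- by rewrite -[X in _ --> X](subr0 1); apply: cvgB => //; exact: cvg_cst.
- exact: cvg_cst.
Qed.

(** At an interior coordinate the coefficient [1 - |p l|^2] stays away from 0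
    while [1 - |phi|^2] tends to 0, which kills the corresponding component. *)
Lemma tame_small F (p : C2 -> C) (P : H -> H) {FF : Filter F} : tame F ->
  (fun l => p l) @ F --> p tau -> nrm (p tau) < 1 ->
  (forall l, bidisk l -> (1 - nrm (p l) ^+ 2) * nrm (P (u l)) ^+ 2 <= 1 - nrm (phi l) ^+ 2) ->
  (fun l => P (u l)) @ F --> 0.
Proof.
move=> Ft pt p1 hp; set d := 1 - nrm (p tau).
have d0 : 0 < d by rewrite subr_gt0.
apply/cvg_nrmP => e e0.
have dee : 0 < d / 2 * e ^+ 2 by rewrite !mulr_gt0 // ?invr_gt0 // exprn_gt0.
have ph : (fun l => 1 - nrm (phi l) ^+ 2) @ F --> (0 : R).
  rewrite -(subrr 1) -[X in 1 - X](expr1n _ 2); apply: cvgB; first exact: cvg_cst.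
  by apply: cvgM; apply: tame_nrm_phi.
move/cvgrPdist_lt : ph => /(_ _ dee) ph.
have pn0 : (fun l => nrm (p l)) @ F --> nrm (p tau) by exact: cvg_nrm.
move/cvgrPdist_lt : pn0 => pn.
have dl : \forall l \near F, bidisk l := tame_bidisk Ft.
near=> l.
have h1 : (1 - nrm (p l) ^+ 2) * nrm (P (u l)) ^+ 2 < d / 2 * e ^+ 2.
  apply: le_lt_trans (hp l _) _; first (near: l; exact: dl).
  apply: le_lt_trans (ler_norm _) _; rewrite -normrN -sub0r; near: l; exact: ph.
have h2 : `|nrm (p tau) - nrm (p l)| < d / 2.
  by near: l; apply: pn; rewrite divr_gt0.
have h3 : d / 2 <= 1 - nrm (p l) ^+ 2.
  by move: h2 (nrm_ge0 (p l)); rewrite ltr_norml /d; move: p1; nra.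
rewrite subr0 -(@ltr_pXn2r _ 2) ?nnegrE ?nrm_ge0 // ?(ltW e0) //.
rewrite -(@ltr_pM2l _ (d / 2)) ?divr_gt0 //; apply: le_lt_trans h1.
by rewrite ler_wpM2r ?sqr_ge0.
Unshelve. all: by end_near. Qed.

Lemma tame_small1 F {FF : Filter F} : tame F -> nrm tau.1 < 1 ->
  (fun l => P1 (u l)) @ F --> 0.
Proof.
move=> Ft t1; apply: (@tame_small _ (fun l => l.1)) => // [|l dl].
  exact: tame_cvg1.
rewrite model_diagonal // lerDl mulr_ge0 ?sqr_ge0// subr_ge0.
by move/bidiskP : dl => [_ /ltW l2]; rewrite expr_le1 // nrm_ge0.
Qed.

Lemma tame_small2 F {FF : Filter F} : tame F -> nrm tau.2 < 1 ->
  (fun l => P2 (u l)) @ F --> 0.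
Proof.
move=> Ft t1; apply: (@tame_small _ (fun l => l.2)) => // [|l dl].
  exact: tame_cvg2.
rewrite model_diagonal // lerDr mulr_ge0 ?sqr_ge0// subr_ge0.
by move/bidiskP : dl => [/ltW l2 _]; rewrite expr_le1 // nrm_ge0.
Qed.

End Model.

(** * Boundary values *)
Section Boundary.
Variables (R : realType) (phi : Cx2 R -> Cx R) (Mu : model phi).
Local Notation C := (Cx R).
Local Notation C2 := (Cx2 R).
Local Notation H := (model_space Mu).
Local Notation P1 := (@comp1 R phi Mu).
Local Notation P2 := (@comp2 R phi Mu).
Local Notation u := (model_map Mu).
Implicit Types (l k : C2) (x y v : H).
Variable tau : C2.
Hypothesis taubd : bidisk_bd tau.
Local Notation tame := (@tame R phi tau).

Lemma tame_finer F G {FG : Filter G} : (G `=>` F)%classic -> tame F -> tame G.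
Proof.
move=> GF [Ft [X FX]]; split; first exact: cvg_trans GF Ft.
by exists X; exact: (GF _ FX).
Qed.

(** One summand of the model equation at two points tending to [tau]: for a
    unimodular coordinate the coefficient tends to 0 and the inner product is
    bounded, for an interior one it is the other way around. *)
Lemma coordinate_vanishes T (F : set_system T) {FF : Filter F} (k l : T -> C2)
    (p : C2 -> C) (P : H -> H) (B : R) : nrm (p tau) <= 1 ->
  (fun t => p (k t)) @ F --> p tau -> (fun t => p (l t)) @ F --> p tau ->
  (forall x, nrm (P x) <= nrm x) ->
  (\forall t \near F, nrm (u (k t)) <= B) -> (\forall t \near F, nrm (u (l t)) <= B) ->
  (nrm (p tau) < 1 -> (fun t => P (u (l t))) @ F --> 0) ->
  (fun t => (1 - p (k t) * conjc (p (l t))) * ip (P (u (k t))) (P (u (l t))) : C)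
    @ F --> (0 : C).
Proof.
move=> p1 pk pl Ple kB lB Psmall.
have cf : (fun t => 1 - p (k t) * conjc (p (l t)) : C) @ F --> (1 - p tau * conjc (p tau) : C).
  apply: cvgB; first exact: cvg_cst.
  by apply: cvg_mulC; [exact: pk|exact: cvg_conj].
move: p1; rewrite le_eqVlt => /orP[/eqP p1|p1].
- move: cf; rewrite mulcJ p1 expr1n subrr => cf.
  under eq_fun do rewrite mulrC.
  apply: (cvg_bounded_mul0 (B := B * B)) => //.
  near=> t; apply: le_trans (CauchySchwarz_ip _ _) _.
  rewrite ler_pM ?nrm_ge0 //; apply: le_trans (Ple _) _; by near: t.
- apply: (cvg_bounded_mul0 (B := nrm (1 - p tau * conjc (p tau) : C) + 1)).
    move/cvg_nrmP : cf => /(_ _ ltr01); apply: filterS => t h.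
    rewrite -lerBlDl; apply: le_trans (ltW h); exact: le_trans (ler_norm _) (ler_dist_nrm _ _).
  apply: (@cvg_nrm_le _ _ _ _ _ _ _ (fun t => B * nrm (P (u (l t))))).
    apply: filterS kB => t tB; rewrite subr0 (le_trans (CauchySchwarz_ip _ _)) //.
    by rewrite ler_wpM2r ?nrm_ge0 // (le_trans (Ple _)).
  rewrite -[X in _ --> X](mulr0 B); apply: cvgM; first exact: cvg_cst.
  by rewrite -[X in _ --> X](@nrm0 R H); apply: cvg_nrm; exact: Psmall.
Unshelve. all: by end_near. Qed.

Lemma tame_two_point T (F : set_system T) {FF : Filter F} (k l : T -> C2) :
  tame (k @ F) -> tame (l @ F) ->
  (fun t => 1 - phi (k t) * conjc (phi (l t)) : C) @ F --> (0 : C).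
Proof.
move=> kt lt; have [t1 t2] := bd_le1 taubd.
have [B B0 kB] := tame_model_bounded Mu kt.
have [B' B'0 lB] := tame_model_bounded Mu lt.
have kBB : \forall t \near F, nrm (u (k t)) <= B + B'.
  have kB' : \forall t \near F, bidisk (k t) /\ nrm (u (k t)) <= B := kB.
  by apply: filterS kB' => t [_ ?]; lra.
have lBB : \forall t \near F, nrm (u (l t)) <= B + B'.
  have lB' : \forall t \near F, bidisk (l t) /\ nrm (u (l t)) <= B' := lB.
  by apply: filterS lB' => t [_ ?]; lra.
pose proof (@coordinate_vanishes T F FF k l (fun l => l.1) P1 (B + B') t1
  (tame_cvg1 kt) (tame_cvg1 lt) (@nrm_comp1_le _ _ Mu) kBB lBB (tame_small1 taubd lt)) as h1.
pose proof (@coordinate_vanishes T F FF k l (fun l => l.2) P2 (B + B') t2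
  (tame_cvg2 kt) (tame_cvg2 lt) (@nrm_comp2_le _ _ Mu) kBB lBB (tame_small2 taubd lt)) as h2.
have {h1 h2} := @cvgD _ C _ F FF _ _ _ _ h1 h2; rewrite addr0 => h.
apply: cvg_trans h; apply: near_eq_cvg.
have kd : \forall t \near F, bidisk (k t) := tame_bidisk kt.
have ld : \forall t \near F, bidisk (l t) := tame_bidisk lt.
near=> t; by rewrite /= [RHS](@model_two_point _ _ Mu) //; near: t; [exact: kd|exact: ld].
Unshelve. all: by end_near. Qed.

(** The identity
    phi l - phi k = phi l (1 - |phi k|^2) - phi k (1 - phi l conj (phi k))
    turns the vanishing of the two-point kernel into a Cauchy property. *)
Lemma tame_phi_close F G {FF : Filter F} {GG : Filter G} : tame F -> tame G ->
  (fun kl => phi kl.2 - phi kl.1 : C) @ filter_prod F G --> (0 : C).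
Proof.
move=> Ft Gt.
have t1 : tame (fst @ filter_prod F G) by apply: tame_finer Ft; exact: cvg_fst.
have t2 : tame (snd @ filter_prod F G) by apply: tame_finer Gt; exact: cvg_snd.
apply: (@cvg_nrm_le _ _ _ _ _ _ _ (fun kl => (1 - nrm (phi kl.1) ^+ 2) +
   nrm (1 - phi kl.2 * conjc (phi kl.1) : C))).
  have d1 : \forall kl \near filter_prod F G, bidisk kl.1 := tame_bidisk t1.
  have d2 : \forall kl \near filter_prod F G, bidisk kl.2 := tame_bidisk t2.
  near=> kl; rewrite subr0.
  have dk : bidisk kl.1 by near: kl; exact: d1.
  have dl : bidisk kl.2 by near: kl; exact: d2.
  have p1 := phi_le1 Mu dk; have p2 := phi_le1 Mu dl.
  have -> : phi kl.2 - phi kl.1 = (phi kl.2 * (1 - nrm (phi kl.1) ^+ 2)%:C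
      - phi kl.1 * (1 - phi kl.2 * conjc (phi kl.1)) : C).
    by rewrite rmorphB /= -mulcJ; ring.
  rewrite (le_trans (ler_nrmB _ _)) // !nrmM nrm_real lerD //.
    by rewrite ger0_norm ?ler_piMl // subr_ge0 expr_le1 // nrm_ge0.
  by rewrite ler_piMl ?nrm_ge0.
rewrite -[X in _ --> X](addr0 0); apply: cvgD.
- rewrite -[X in _ --> X](subrr 1) -[X in 1 - X](expr1n _ 2).
  apply: cvgB; first exact: cvg_cst.
  have ph : (fun kl => nrm (phi kl.1)) @ filter_prod F G --> (1 : R).
    exact: (tame_nrm_phi Mu taubd t1).
  by apply: cvgM; exact: ph.
- by rewrite -[X in _ --> X](@nrm0 R C); apply: cvg_nrm; exact: tame_two_point.
Unshelve. all: by end_near. Qed.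

Lemma tame_limit F0 {FF0 : ProperFilter F0} : tame F0 ->
  exists2 w : C, nrm w = 1 & forall F, Filter F -> tame F -> phi @ F --> w.
Proof.
move=> F0t.
have [w phiw] : exists w : C, phi @ F0 --> w.
  apply: complex_cauchy => e e0.
  pose proof (tame_phi_close F0t F0t) as h.
  move/cvg_nrmP : h => /(_ _ e0)[[A B] /= [FA FB] AB].
  have [k Ak] := filter_ex FA; exists (phi k); apply: filterS FB => l Bl.
  by rewrite -[X in nrm X]subr0; apply: (AB (k, l) (conj Ak Bl)).
exists w.
  apply: (cvg_unique (@norm_hausdorff _ _) (cvg_nrm phiw)) => //.
  exact: (tame_nrm_phi Mu taubd F0t).
move=> F FF Ft; apply/cvg_nrmP => e e0.
have e2 : 0 < e / 2 by rewrite divr_gt0.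
pose proof (tame_phi_close F0t Ft) as h.
move/cvg_nrmP : h => /(_ _ e2)[[A B] /= [FA FB] AB].
move/cvg_nrmP : phiw => /(_ _ e2) phiw.
have [k [Ak pk]] := filter_ex (filterI FA phiw).
apply: filterS FB => l Bl; have := AB (k, l) (conj Ak Bl); rewrite /= subr0 => h.
rewrite -(subrK (phi k) (phi l)) -addrA (le_lt_trans (ler_nrmD _ _)) //.
by rewrite [ltRHS]splitr ltrD.
Qed.

Lemma quotientE l : caratheodory_quotient phi l = (1 - nrm (phi l)) / (1 - nrm l).
Proof. by rewrite /caratheodory_quotient !nrmE -[1]/(1%:C) -!rmorphB -fmorph_div. Qed.

(** The finite limes inferior provides a level [X] such that the points of the
    bidisk with quotient at most [X] accumulate at [tau]; the trace of the
    neighbourhoods of [tau] on these points is a tame filter. *)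
Lemma Bpoint_tame : is_Bpoint phi tau ->
  exists F, ProperFilter F /\ tame F.
Proof.
move=> [_ qlt].
have [X hX] : exists X : R, forall A, within (@bidisk R) (nbhs tau) A ->
    exists2 l, A l & caratheodory_quotient phi l <= X.
  move: qlt; rewrite /limf_einf /= lteNl; set L := limf_esup _ _ => L0.
  have [y yL] : exists y : R, (y%:E < L)%E.
    case: L L0 => [r _|_|//]; [exists (r - 1)|by exists 0; rewrite ltry].
    by rewrite lte_fin ltrBlDr ltrDl.
  exists (- y) => A FA.
  have : (y%:E < ereal_sup
      [set (\- (fun l => (caratheodory_quotient phi l)%:E))%E l | l in A])%E.
    by apply: lt_le_trans yL _; apply: ereal_inf_lbound; exists A.
  move=> /ereal_sup_gt[_ [l Al <-]] /=; rewrite lte_fin => yq.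
  by exists l => //; rewrite lerNr ltW.
pose D := [set l | bidisk l /\ caratheodory_quotient phi l <= X].
exists (within D (nbhs tau)); split.
  apply: Build_ProperFilter_ex => A; rewrite /within /= => AD.
  have [|l [dl Al] lX] := hX [set l | bidisk l /\ (D l -> A l)].
    by apply: filterS AD => l h dl.
  by exists l; apply: Al.
split; first exact: cvg_within.
exists X; apply: filterS (@filterT _ (nbhs tau) _) => l _ [dl].
have l1 : 0 < 1 - nrm l by rewrite subr_gt0; exact/bidisk_nrm.
by rewrite quotientE ler_pdivrMr // => qX; split.
Qed.

(** The two-point estimate between an approach region and a tame filter keeps
    the model bounded on the region: (1 - |l|) |u_l|^2 is at most a multiple of
    |tau - l| |u_l|. *)
Lemma nontangential_tame F0 {FF0 : ProperFilter F0} S F {FF : Filter F} : tame F0 ->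
  approaches_nontangentially S tau -> F --> tau -> F S -> tame F.
Proof.
move=> F0t [Sb _ [c c0 Sc]] Ft FS; split=> //.
have [B B0 uB] := tame_model_bounded Mu F0t.
exists (2 * c * B * (4 * c * B)); apply: filterS FS => l Sl.
have dl := Sb _ Sl; split=> //.
have {Sc} := Sc _ Sl; rewrite !nrmE -[1]/(1%:C) -rmorphB -rmorphM /= lecR => lc.
have l1 : 0 < 1 - nrm l by rewrite subr_gt0; exact/bidisk_nrm.
have coord (p : C2 -> C) (P : H -> H) : nrm (p l) <= nrm l -> nrm (p tau) <= 1 ->
    nrm (p tau - p l) <= nrm (tau - l) -> (forall x, nrm (P x) <= nrm x) ->
    p @ F0 --> p tau -> (nrm (p tau) < 1 -> (fun k => P (u k)) @ F0 --> 0) ->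
    forall e, 0 < e -> \forall k \near F0,
      nrm (1 - p l * conjc (p k) : C) * (nrm (P (u l)) * nrm (P (u k))) <=
      c * (1 - nrm l) * (nrm (u l) * B) + e.
  move=> pl pt ptl Ple pc Psm e e0.
  move: pt; rewrite le_eqVlt => /orP[/eqP pt|pt].
  - have cf : (fun k => nrm (1 - p l * conjc (p k) : C) * (nrm (u l) * B)) @ F0 -->
        nrm (1 - p l * conjc (p tau) : C) * (nrm (u l) * B).
      apply: cvgM; last exact: cvg_cst.
      apply: cvg_nrm; apply: cvgB; first exact: cvg_cst.
      by apply: cvg_mulC; [exact: cvg_cst|exact: cvg_conj].
    have eq1 : nrm (1 - p l * conjc (p tau) : C) = nrm (p tau - p l).
      have -> : (1 - p l * conjc (p tau) : C) = (p tau - p l) * conjc (p tau).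
        by rewrite mulrBl mulcJ pt expr1n.
      by rewrite nrmM nrmJ pt mulr1.
    rewrite eq1 in cf; move/cvgrPdist_lt : cf => /(_ _ e0) cf.
    near=> k.
    have kB : nrm (u k) <= B by near: k; apply: filterS uB => k [].
    have h : `|nrm (p tau - p l) * (nrm (u l) * B) -
       nrm (1 - p l * conjc (p k) : C) * (nrm (u l) * B)| < e by near: k; exact: cf.
    have h2 : nrm (p tau - p l) * (nrm (u l) * B) <= c * (1 - nrm l) * (nrm (u l) * B).
      by rewrite ler_wpM2r ?mulr_ge0 ?nrm_ge0 // (le_trans ptl).
    have h3 : nrm (1 - p l * conjc (p k) : C) * (nrm (P (u l)) * nrm (P (u k))) <=
        nrm (1 - p l * conjc (p k) : C) * (nrm (u l) * B).
      rewrite ler_wpM2l ?nrm_ge0 // ler_pM ?nrm_ge0 //.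
      exact: le_trans (Ple _) kB.
    by move: h; rewrite ltr_norml; move: h2 h3; lra.
  - have cf : (fun k => nrm (1 - p l * conjc (p k) : C) *
          (nrm (P (u l)) * nrm (P (u k)))) @ F0 -->
        nrm (1 - p l * conjc (p tau) : C) * (nrm (P (u l)) * 0).
      apply: cvgM; last first.
        apply: cvgM; first exact: cvg_cst.
        by rewrite -[X in _ --> X](@nrm0 R H); apply: cvg_nrm; exact: Psm.
      apply: cvg_nrm; apply: cvgB; first exact: cvg_cst.
      by apply: cvg_mulC; [exact: cvg_cst|exact: cvg_conj].
    rewrite !mulr0 in cf; move/cvgrPdist_lt : cf => /(_ _ e0).
    apply: filterS => k; rewrite sub0r normrN => h.
    have : 0 <= c * (1 - nrm l) * (nrm (u l) * B).
      by rewrite !mulr_ge0 ?nrm_ge0 // ltW.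
    by move: h; rewrite ltr_norml; lra.
have key : 1 - nrm (phi l) <= 2 * c * B * nrm (u l) * (1 - nrm l).
  apply/ler_addgt0Pr => e e0; have e2 : 0 < e / 2 by rewrite divr_gt0.
  have [t1 t2] := bd_le1 taubd.
  have l1le : nrm l.1 <= nrm l by rewrite (nrm_pair l) le_max lexx.
  have l2le : nrm l.2 <= nrm l by rewrite (nrm_pair l) le_max lexx orbT.
  have d1le : nrm (tau.1 - l.1) <= nrm (tau - l) by rewrite (nrm_pair (tau - l)) le_max lexx.
  have d2le : nrm (tau.2 - l.2) <= nrm (tau - l).
    by rewrite (nrm_pair (tau - l)) le_max lexx orbT.
  pose proof (coord (fun l => l.1) P1 l1le t1 d1le (@nrm_comp1_le _ _ Mu)
    (tame_cvg1 F0t) (tame_small1 taubd F0t) _ e2) as h1.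
  pose proof (coord (fun l => l.2) P2 l2le t2 d2le (@nrm_comp2_le _ _ Mu)
    (tame_cvg2 F0t) (tame_small2 taubd F0t) _ e2) as h2.
  have [k [[[h1k h2k] [dk _]]]] := filter_ex (filterI (filterI h1 h2) uB).
  have := model_sub_le Mu dl dk; have := model_two_point_le Mu dl dk.
  move: h1k h2k; lra.
have ub := model_bound Mu dl.
have u4 : nrm (u l) <= 4 * c * B.
  have [u0|u0] := eqVneq (nrm (u l)) 0; first by rewrite u0 !mulr_ge0 // ltW.
  have up : 0 < nrm (u l) by rewrite lt_def u0 nrm_ge0.
  rewrite -(ler_pM2r up) -(ler_pM2r l1).
  apply: le_trans (_ : _ <= 2 * (1 - nrm (phi l))) _; first by move: ub; rewrite expr2.
  by move: key; lra.
apply: le_trans key _; rewrite ler_wpM2r ?(ltW l1) // ler_wpM2l // !mulr_ge0 // ltW //.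
Unshelve. all: by end_near. Qed.

End Boundary.

(** * Rays *)
Section Rays.
Variables (R : realType) (phi : Cx2 R -> Cx R) (Mu : model phi).
Local Notation C := (Cx R).
Local Notation C2 := (Cx2 R).
Local Notation H := (model_space Mu).
Local Notation P1 := (@comp1 R phi Mu).
Local Notation P2 := (@comp2 R phi Mu).
Local Notation u := (model_map Mu).
Implicit Types (l k : C2) (x y v : H).
Variable tau : C2.
Hypothesis taubd : bidisk_bd tau.
Local Notation tame := (@tame R phi tau).

Definition ray (M t : R) : C2 := tau + t%:C *: - (tau.1, tau.2 * M%:C).

Lemma ray1 M t : (ray M t).1 = (1 - t)%:C * tau.1.
Proof. by rewrite /= /GRing.scale /= mulrN rmorphB mulrBl mul1r. Qed.

Lemma ray2 M t : (ray M t).2 = (1 - t * M)%:C * tau.2.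
Proof.
rewrite /= /GRing.scale /= mulrN rmorphB rmorphM /= mulrBl mul1r.
by rewrite -mulrA [tau.2 * _]mulrC.
Qed.

Lemma ray_dist M t : 0 <= t -> 0 <= M -> nrm (tau - ray M t) <= t * (1 + M).
Proof.
move=> t0 M0; have [t1 t2] := bd_le1 taubd.
have -> : tau - ray M t = t%:C *: (tau.1, tau.2 * M%:C).
  by rewrite /ray opprD addrA subrr add0r scalerN opprK.
rewrite nrmZ nrm_real ger0_norm // ler_wpM2l // nrm_pair /= nrmM nrm_real ger0_norm //.
rewrite ge_max; apply/andP; split; first lra.
have := nrm_ge0 tau.2; nra.
Qed.

Lemma ray_nrm M t : 0 < M -> 0 < t < (1 + M)^-1 -> t * (M / (1 + M)) <= 1 - nrm (ray M t).
Proof.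
move=> M0 /andP[t0 tM]; have [t1 t2] := bd_le1 taubd.
have M1 : 0 < 1 + M by lra.
have tM1 : t * (1 + M) < 1 by rewrite -ltr_pdivlMr // mul1r.
have e1 : M / (1 + M) <= 1 by rewrite ler_pdivrMr //; lra.
have e2 : M / (1 + M) <= M by rewrite ler_pdivrMr //; nra.
have a1 : nrm (ray M t).1 <= 1 - t.
  rewrite ray1 nrmM nrm_real ger0_norm; [|nra].
  by rewrite ler_piMr //; nra.
have a2 : nrm (ray M t).2 <= 1 - t * M.
  rewrite ray2 nrmM nrm_real ger0_norm; [|nra].
  by rewrite ler_piMr //; nra.
rewrite lerBrDr -lerBrDl (nrm_pair (ray M t)) ge_max; apply/andP; split.
- by apply: le_trans a1 _; rewrite lerD2l lerN2 ler_piMr // ltW.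
- by apply: le_trans a2 _; rewrite lerD2l lerN2 ler_wpM2l // ltW.
Qed.

Lemma ray_near M : 0 < M -> \forall t \near (0 : R)^'+, 0 < t < (1 + M)^-1.
Proof.
move=> M0; near=> t; apply/andP; split; first by near: t; exact: nbhs_right_gt.
by near: t; apply: nbhs_right_lt; rewrite invr_gt0; lra.
Unshelve. all: by end_near. Qed.

Lemma ray_cvg M : 0 < M -> ray M @ (0 : R)^'+ --> tau.
Proof.
move=> M0; apply/cvg_nrmP => e e0.
have eM : 0 < e / (1 + M) by rewrite divr_gt0 //; lra.
near=> t.
have t0 : 0 < t by near: t; exact: nbhs_right_gt.
have te : t < e / (1 + M) by near: t; exact: nbhs_right_lt.
rewrite nrmBC (le_lt_trans (ray_dist (ltW t0) (ltW M0))) //.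
by rewrite -ltr_pdivlMr //; lra.
Unshelve. all: by end_near. Qed.

Definition ray_set M := [set ray M t | t in [set t | 0 < t < (1 + M)^-1]].

Lemma ray_nontangential M : 0 < M -> approaches_nontangentially (ray_set M) tau.
Proof.
move=> M0; have M1 : 0 < 1 + M by lra.
split.
- move=> _ [t /= tM <-]; apply/bidisk_nrm.
  have := ray_nrm M0 tM; move/andP : tM => [t0 _].
  have : 0 < t * (M / (1 + M)) by rewrite !mulr_gt0 // invr_gt0.
  by lra.
- move=> A /(ray_cvg M0) At.
  have At' : \forall t \near (0 : R)^'+, A (ray M t) := At.
  pose proof (@filter_ex _ ((0 : R)^'+) _ _ (filterI At' (ray_near M0))) as [t [tA tM]].
  by exists (ray M t); split => //; exists t.
- exists ((1 + M) ^+ 2 / M); first by rewrite divr_gt0 // exprn_gt0.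
  move=> _ [t /= tM <-]; have h := ray_nrm M0 tM; move/andP : tM => [t0 _].
  rewrite !nrmE (_ : 1 - _ = (1 - nrm (ray M t))%:C); last by rewrite rmorphB.
  rewrite -rmorphM lecR.
  apply: le_trans (ray_dist (ltW t0) (ltW M0)) _.
  apply: (@le_trans _ _ ((1 + M) ^+ 2 / M * (t * (M / (1 + M))))); last first.
    by rewrite ler_wpM2l // divr_ge0 // ?sqr_ge0 // ltW.
  by rewrite le_eqVlt; apply/orP; left; apply/eqP; field; rewrite !gt_eqF.
Qed.

Lemma ray_tame F0 {FF0 : ProperFilter F0} M : tame F0 -> 0 < M -> tame (ray M @ (0 : R)^'+).
Proof.
move=> F0t M0; apply: (nontangential_tame Mu taubd F0t (ray_nontangential M0)).
  exact: ray_cvg.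
by apply: filterS (ray_near M0) => t tM; exists t.
Qed.

Lemma nontangential_proper : ProperFilter (nontangential tau).
Proof.
apply: Build_ProperFilter_ex => A hA.
have [Sb clo _] := ray_nontangential ltr01.
have [l [Sl Al]] := clo _ (hA _ (ray_nontangential ltr01)).
by exists l; apply: Al.
Qed.

Lemma boundary_value_tame : is_Bpoint phi tau ->
  nrm (boundary_value phi tau) = 1 /\
  forall F, Filter F -> tame F -> phi @ F --> boundary_value phi tau.
Proof.
move=> /Bpoint_tame[F0 [FF0 F0t]].
have [w w1 hw] := tame_limit Mu taubd F0t.
have nt := nontangential_proper.
suff -> : boundary_value phi tau = w by [].
apply: cvg_lim; first exact: norm_hausdorff.
move=> A wA S hS; have := hw (within S (nbhs tau)) _; apply => //.
apply: (nontangential_tame Mu taubd F0t hS); first exact: cvg_within.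
exact: withinT.
Qed.

End Rays.

(** * Weighted inner products and convergence of curves *)
Section Curve.
Variables (R : realType) (phi : Cx2 R -> Cx R) (Mu : model phi).
Local Notation C := (Cx R).
Local Notation H := (model_space Mu).
Local Notation P1 := (@comp1 R phi Mu).
Local Notation P2 := (@comp2 R phi Mu).
Implicit Types (x y v w : H) (m : R).

(** The form that the model equation produces along the ray in direction
    [(tau.1, tau.2 * m)], where the coefficient of the second component is [m]
    times that of the first one. *)
Definition wip m x y : C := ip (P1 x) (P1 y) + m%:C * ip (P2 x) (P2 y).
Definition wsq m x : R := nrm (P1 x) ^+ 2 + m * nrm (P2 x) ^+ 2.

Lemma wsq_ge0 m x : 0 <= m -> 0 <= wsq m x.
Proof. by move=> m0; rewrite /wsq addr_ge0 ?sqr_ge0 // mulr_ge0 ?sqr_ge0. Qed.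

Lemma wip_xx m x : wip m x x = (wsq m x)%:C.
Proof. by rewrite /wip !ipxx -rmorphM -rmorphD. Qed.

Lemma wip_le m x y : 0 <= m -> nrm (wip m x y) <= (1 + m) * nrm x * nrm y.
Proof.
move=> m0; rewrite -mulrA mulrDl mul1r (le_trans (ler_nrmD _ _)) // nrmM nrm_real ger0_norm //.
rewrite lerD // ?ler_wpM2l // (le_trans (CauchySchwarz_ip _ _)) //.
- by rewrite ler_pM ?nrm_ge0 ?nrm_comp1_le.
- by rewrite ler_pM ?nrm_ge0 ?nrm_comp2_le.
Qed.

Lemma wipBl m x y v : wip m (x - y) v = wip m x v - wip m y v.
Proof. by rewrite /wip comp1B comp2B !ipBl; ring. Qed.

Lemma wsqB m x y :
  wsq m (x - y) = wsq m x + wsq m y - 2 * complex.Re (wip m x y).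
Proof.
rewrite /wsq comp1B comp2B !nrmB_sqr /wip raddfD /=.
have -> : complex.Re (m%:C * ip (P2 x) (P2 y)) = m * complex.Re (ip (P2 x) (P2 y)).
  by case: (ip _ _) => a b /=; rewrite mul0r subr0.
ring.
Qed.

Lemma wipE m x y : wip m x y = ip x (P1 y) + m%:C * ip x (P2 y).
Proof. by rewrite /wip -ip_comp1 comp1K ip_comp1 -ip_comp2 comp2K ip_comp2. Qed.

Lemma wipC m x y : wip m y x = conjc (wip m x y).
Proof.
rewrite /wip rmorphD rmorphM /= -!ipC; congr (_ + _ * _).
by symmetry; exact: conjc_real.
Qed.

Lemma cvg_wip_r m T (F : set_system T) {FF : Filter F} (f : T -> H) x y : 0 <= m ->
  f @ F --> y -> (fun t => wip m x (f t)) @ F --> wip m x y.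
Proof.
move=> m0 fy; apply: (@cvg_nrm_le _ _ _ _ _ _ _ (fun t => (1 + m) * nrm x * nrm (f t - y))).
  apply: filterS (@filterT _ F _) => t _.
  have -> : wip m x (f t) - wip m x y = conjc (wip m (f t - y) x).
    by rewrite wipBl rmorphB /= -!wipC.
  by rewrite nrmJ (le_trans (wip_le _ _ m0)) // mulrAC.
rewrite -[X in _ --> X](mulr0 ((1 + m) * nrm x)); apply: cvgM; first exact: cvg_cst.
exact/cvg_nrm0P.
Qed.

Lemma cvg_wip_l m T (F : set_system T) {FF : Filter F} (f : T -> H) x y : 0 <= m ->
  f @ F --> y -> (fun t => wip m (f t) x) @ F --> wip m y x.
Proof.
move=> m0 fy; under eq_fun do rewrite wipC.
by rewrite wipC; apply: cvg_conj; exact: cvg_wip_r.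
Qed.

(** A curve [f] whose inner products with each of its own points [f t] converge,
    to [G t], is Cauchy as soon as |f t|^2 is at most [Re (G t)] up to a vanishing
    error: expanding |f t - f s|^2 >= 0 gives liminf |f s|^2 >= 2 Re (G t) - |f t|^2,
    so the squared lengths are almost nondecreasing and converge, and then the same
    expansion tends to 0.  The weight [m] may be 0, in which case the second
    component has to be controlled separately. *)
Lemma curve_limit T (F : set_system T) {FF : ProperFilter F} (c : T -> R) (f : T -> H)
    (G : T -> C) m (B : R) : 0 <= m ->
  (\forall t \near F, nrm (f t) <= B) ->
  (\forall t \near F, (fun s => wip m (f t) (f s)) @ F --> G t) ->
  (\forall t \near F, wsq m (f t) <= complex.Re (G t) + c t) ->
  c @ F --> 0 ->
  (0 < m \/ (fun t => P2 (f t)) @ F --> 0) ->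
  exists w : H, f @ F --> w /\ G @ F --> ((wsq m w)%:C : C).
Proof.
move=> m0 fB fG fle c0 mpos.
have Fsq : \forall t \near F, 0 <= wsq m (f t) <= (1 + m) * B ^+ 2.
  apply: filterS fB => t tB; rewrite wsq_ge0 //=.
  have := nrm_ge0 (f t); have := @nrm_comp1_le _ _ Mu (f t).
  have := @nrm_comp2_le _ _ Mu (f t); have := nrm_ge0 (P1 (f t)).
  have := nrm_ge0 (P2 (f t)); rewrite /wsq => p2 p1 l2 l1 f0.
  have h1 : nrm (P1 (f t)) ^+ 2 <= B ^+ 2 by rewrite ler_pXn2r ?nnegrE //; lra.
  have h2 : nrm (P2 (f t)) ^+ 2 <= B ^+ 2 by rewrite ler_pXn2r ?nnegrE //; lra.
  by rewrite mulrDl mul1r lerD // ler_wpM2l.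
have [L fL] : exists L : R, (fun t => wsq m (f t)) @ F --> L.
  apply: (@cvg_almost_nondecreasing _ _ _ _ _ (fun t => 2 * c t) _ Fsq).
    by rewrite -[X in _ --> X](mulr0 2); apply: cvgM => //; exact: cvg_cst.
  apply: filterS2 fG fle => t fGt flet e e0.
  pose proof (cvg_Re fGt) as h; move/cvgrPdist_lt : h => /(_ (e / 2)).
  rewrite divr_gt0 // => /(_ isT); apply: filterS => s; rewrite ltr_norml => h.
  have := wsq_ge0 (f t - f s) m0; rewrite wsqB.
  by move: h flet; lra.
have dlim : \forall t \near F, (fun s => wsq m (f t - f s)) @ F -->
    wsq m (f t) + L - 2 * complex.Re (G t).
  apply: filterS fG => t fGt; under eq_fun do rewrite wsqB.
  apply: cvgB; first by apply: cvgD => //; exact: cvg_cst.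
  by apply: cvgM; [exact: cvg_cst|exact: cvg_Re].
have dge : \forall t \near F, 0 <= wsq m (f t) + L - 2 * complex.Re (G t).
  apply: filterS dlim => t tlim; rewrite -(cvg_lim _ tlim) //.
  apply: limr_ge; first by apply/cvg_ex; eexists; exact: tlim.
  by apply: filterS (@filterT _ F _) => s _; exact: wsq_ge0.
have d0 : (fun t => wsq m (f t) + L - 2 * complex.Re (G t)) @ F --> (0 : R).
  apply: (@squeeze_cvgr _ _ _ _ (cst 0) (fun t => (L - wsq m (f t)) + 2 * c t)).
  - by apply: filterS2 dge fle => t -> ; rewrite /=; lra.
  - exact: cvg_cst.
  - rewrite -[X in _ --> X](addr0 0); apply: cvgD.
      by rewrite -[X in _ --> X](subrr L); apply: cvgB => //; exact: cvg_cst.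
    by rewrite -[X in _ --> X](mulr0 2); apply: cvgM => //; exact: cvg_cst.
have cau e : 0 < e -> \forall t \near F, \forall s \near F, wsq m (f t - f s) < e.
  move=> e0; move/cvgrPdist_lt : d0 => /(_ _ e0) d0.
  apply: filterS2 dlim d0 => t tlim.
  rewrite /= sub0r normrN => /(le_lt_trans (ler_norm _)) td.
  exact: (cvgr_lt _ tlim).
have [w fw] : exists w : H, f @ F --> w.
  apply: hilbert_cauchy => e e0; case: mpos => [mp|P20].
  - have ee : 0 < e ^+ 2 * (m / (1 + m)) by rewrite mulr_gt0 ?exprn_gt0 // divr_gt0 //; lra.
    have [t ht] := filter_ex (cau _ ee); exists (f t); apply: filterS ht => s.
    rewrite nrmBC -[nrm _ < e](@ltr_pXn2r _ 2) ?nnegrE ?nrm_ge0 // ?(ltW e0) //.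
    rewrite nrm_comp_sqr /wsq; set a := nrm _ ^+ 2; set b := nrm _ ^+ 2.
    have a0 : 0 <= a by exact: sqr_ge0.
    have b0 : 0 <= b by exact: sqr_ge0.
    rewrite mulrA ltr_pdivlMr; last by lra.
    by move=> h; rewrite -(ltr_pM2r mp); apply: le_lt_trans h; nra.
  - have ee : 0 < e ^+ 2 / 2 by rewrite divr_gt0 // exprn_gt0.
    have e4 : 0 < e / 4 by rewrite divr_gt0.
    move/cvg_nrmP : P20 => /(_ _ e4) P2s.
    have [t [ht]] := filter_ex (filterI (cau _ ee) P2s); rewrite subr0 => P2t.
    exists (f t); apply: filterS2 ht P2s => s hs; rewrite subr0 => P2s.
    rewrite nrmBC -[nrm _ < e](@ltr_pXn2r _ 2) ?nnegrE ?nrm_ge0 // ?(ltW e0) //.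
    rewrite nrm_comp_sqr; have P2ts := ler_nrmB (P2 (f t)) (P2 (f s)).
    rewrite -comp2B in P2ts; have n0 := nrm_ge0 (P2 (f t - f s)).
    have h2 : nrm (P2 (f t - f s)) ^+ 2 <= (e / 2) ^+ 2.
      by rewrite ler_pXn2r ?nnegrE //; lra.
    have h1 : 0 <= m * nrm (P2 (f t - f s)) ^+ 2 by rewrite mulr_ge0 ?sqr_ge0.
    have := exprn_gt0 2 e0; move: hs h1 h2; rewrite /wsq exprMn.
    have -> : (2^-1 ^+ 2 : R) = 4^-1 by field.
    by lra.
exists w; split=> //.
have Gw : \forall t \near F, wip m (f t) w = G t.
  apply: filterS fG => t fGt; apply: (cvg_unique (@norm_hausdorff _ _)) fGt.
  exact: cvg_wip_r.
rewrite -wip_xx; pose proof (@cvg_wip_l m T F _ f w w m0 fw) as h.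
by apply: cvg_trans h; exact: near_eq_cvg.
Qed.
End Curve.

(** * Limits of the model along rays *)
Section Direction.
Variables (R : realType) (phi : Cx2 R -> Cx R) (Mu : model phi).
Local Notation C := (Cx R).
Local Notation C2 := (Cx2 R).
Local Notation H := (model_space Mu).
Local Notation P1 := (@comp1 R phi Mu).
Local Notation P2 := (@comp2 R phi Mu).
Local Notation u := (model_map Mu).
Implicit Types (l k : C2) (x y v : H).
Variable tau : C2.
Hypothesis Btau : is_Bpoint phi tau.
Hypothesis phitau : boundary_value phi tau = tau.1.
Local Notation tame := (@tame R phi tau).
Local Notation ray := (ray tau).

Let taubd : bidisk_bd tau. Proof. by have [] := Btau. Qed.

Lemma nrm_tau1 : nrm tau.1 = 1.
Proof. by rewrite -phitau; have [] := boundary_value_tame Mu taubd Btau. Qed.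

Lemma tame_phi F {FF : Filter F} : tame F -> phi @ F --> tau.1.
Proof. by rewrite -phitau; have [_] := boundary_value_tame Mu taubd Btau; apply. Qed.

Lemma ray_tameB M : 0 < M -> tame (ray M @ (0 : R)^'+).
Proof.
by move=> M0; have [F0 [FF0 F0t]] := Bpoint_tame Btau; exact: (ray_tame Mu taubd F0t).
Qed.

Lemma tau1_neq0 : tau.1 != 0.
Proof.
apply/eqP => t10; have := nrm_tau1.
by rewrite t10 nrm0 => /eqP; rewrite eq_sym oner_eq0.
Qed.

(** The weight of the second coordinate in the direction [(tau.1, tau.2 * M)]:
    when [tau.2] is interior the second component of the model vanishes in the
    limit and is discarded. *)
Definition weight (M : R) : R := if nrm tau.2 == 1 then M else 0.

Definition slope M t : C := (1 - phi (ray M t) * conjc tau.1) / t%:C.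

Lemma weight_ge0 M : 0 <= M -> 0 <= weight M.
Proof. by rewrite /weight; case: ifP. Qed.

(** On the ray, [1 - l.1 * conj tau.1] equals [t] and, when [tau.2] is
    unimodular, [1 - l.2 * conj tau.2] equals [t * M]; so letting only the second
    point of the model equation tend to [tau] produces a weighted inner product. *)
Lemma tame_slope F {FF : Filter F} M t : tame F -> 0 < t -> bidisk (ray M t) ->
  (fun k => wip (weight M) (u (ray M t)) (u k)) @ F --> slope M t.
Proof.
move=> Ft t0 dt; set a := ray M t; set m := weight M.
have [B B0 uB] := tame_model_bounded Mu Ft.
have tau1 := nrm_tau1; have [_ tau2] := bd_le1 taubd.
have uB' : \forall k \near F, nrm (u k) <= B by apply: filterS uB => k [].
have c1 : (fun k => t%:C - (1 - a.1 * conjc k.1) : C) @ F --> (0 : C).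
  have e : (t%:C - (1 - a.1 * conjc tau.1) : C) = 0.
    rewrite /a ray1 -mulrA mulcJ tau1 expr1n mulr1 rmorphB rmorph1; ring.
  rewrite -[X in _ --> X]e; apply: cvgB; first exact: cvg_cst.
  apply: cvgB; first exact: cvg_cst.
  by apply: cvg_mulC; [exact: cvg_cst|apply: cvg_conj; exact: (tame_cvg1 Ft)].
have l1 : (fun k => ip (P1 (u a)) (P1 (u k)) * (t%:C - (1 - a.1 * conjc k.1)) : C)
    @ F --> (0 : C).
  apply: (cvg_bounded_mul0 (B := nrm (u a) * B)) => //.
  apply: filterS uB' => k kB; rewrite (le_trans (CauchySchwarz_ip _ _)) //.
  by rewrite ler_pM ?nrm_ge0 ?nrm_comp1_le // (le_trans (nrm_comp1_le _)).
have c2 : (fun k => (t * m)%:C - (1 - a.2 * conjc k.2) : C) @ F -->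
    ((t * m)%:C - (1 - a.2 * conjc tau.2) : C).
  apply: cvgB; first exact: cvg_cst.
  apply: cvgB; first exact: cvg_cst.
  by apply: cvg_mulC; [exact: cvg_cst|apply: cvg_conj; exact: (tame_cvg2 Ft)].
have l2 : (fun k => ip (P2 (u a)) (P2 (u k)) * ((t * m)%:C - (1 - a.2 * conjc k.2)) : C)
    @ F --> (0 : C).
  have [t2|t2] := eqVneq (nrm tau.2) 1.
  - apply: (cvg_bounded_mul0 (B := nrm (u a) * B)).
      apply: filterS uB' => k kB; rewrite (le_trans (CauchySchwarz_ip _ _)) //.
      by rewrite ler_pM ?nrm_ge0 ?nrm_comp2_le // (le_trans (nrm_comp2_le _)).
    have e : ((t * m)%:C - (1 - a.2 * conjc tau.2) : C) = 0.
      rewrite /m /weight t2 eqxx /a ray2 -mulrA mulcJ t2 expr1n mulr1 rmorphB rmorph1; ring.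
    by rewrite -[X in _ --> X]e.
  - have P20 : (fun k => P2 (u k)) @ F --> 0.
      by apply: (tame_small2 taubd Ft); rewrite lt_neqAle t2.
    rewrite (_ : (0 : C) = ip (P2 (u a)) 0 * ((t * m)%:C - (1 - a.2 * conjc tau.2)));
      last by rewrite ip0r mul0r.
    apply: cvg_mulC c2.
    apply: (@cvg_nrm_le _ _ _ _ _ _ _ (fun k => nrm (P2 (u a)) * nrm (P2 (u k)))).
      apply: filterS (@filterT _ F _) => k _.
      by rewrite ip0r subr0 CauchySchwarz_ip.
    rewrite -[X in _ --> X](mulr0 (nrm (P2 (u a)))); apply: cvgM; first exact: cvg_cst.
    by rewrite -[X in _ --> X](@nrm0 R H); exact: cvg_nrm.
have l0 : (fun k => 1 - phi a * conjc (phi k) : C) @ F --> (1 - phi a * conjc tau.1 : C).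
  apply: cvgB; first exact: cvg_cst.
  by apply: cvg_mulC; [exact: cvg_cst|apply: cvg_conj; exact: (tame_phi Ft)].
pose proof (@cvgD _ C _ F _ _ _ _ _ (@cvgD _ C _ F _ _ _ _ _ l0 l1) l2) as l012.
rewrite !addr0 in l012.
pose proof (@cvg_mulC R _ F _ _ (fun=> t%:C^-1) _ _ l012 (cvg_cst _)) as lim.
apply: cvg_trans lim; apply: near_eq_cvg.
have dF : \forall k \near F, bidisk k by apply: filterS uB => k [].
near=> k.
have dk : bidisk k by near: k; exact: dF.
have e := model_two_point Mu dt dk; rewrite -/a in e.
transitivity ((1 - phi a * conjc (phi k)
  + ip (P1 (u a)) (P1 (u k)) * (t%:C - (1 - a.1 * conjc k.1))
  + ip (P2 (u a)) (P2 (u k)) * ((t * m)%:C - (1 - a.2 * conjc k.2))) / t%:C); first by [].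
rewrite e /wip rmorphM.
have tn : (t%:C : C) != 0 by rewrite -[0]/(0%:C) (inj_eq (@complexI R)) gt_eqF.
by field.
Unshelve. all: by end_near. Qed.

(** The diagonal of the model equation, together with
    1 - |z|^2 <= 2 Re (1 - z), compares |u|^2 with the real part of the slope;
    the error comes from 1 - (1 - t)^2 = 2 t - t^2. *)
Lemma slope_bound M t : 0 < M -> 0 < t < (1 + M)^-1 ->
  wsq (weight M) (u (ray M t)) <=
    complex.Re (slope M t) + t * ((1 + M ^+ 2) / 2 * nrm (u (ray M t)) ^+ 2).
Proof.
move=> M0 tM; have dt : bidisk (ray M t).
  have [Sb _ _] := ray_nontangential taubd M0; apply: Sb; exists t => //.
move/andP : tM => [t0 tM].
have M1 : 0 < 1 + M by lra.
have tM1 : t * (1 + M) < 1 by rewrite -ltr_pdivlMr // mul1r.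
set a := ray M t in dt *.
have tau1 := nrm_tau1; have [_ tau2] := bd_le1 taubd.
have tn : t != 0 by rewrite gt_eqF.
have reG : t * complex.Re (slope M t) = 1 - complex.Re (phi a * conjc tau.1).
  rewrite /slope -/a -fmorphV /=.
  case: (1 - _) (raddfB (@complex.Re R) 1 (phi a * conjc tau.1)) => x y /= <-.
  by rewrite mulr0 subr0; field.
have h : 1 - nrm (phi a) ^+ 2 <= 2 * t * complex.Re (slope M t).
  rewrite -mulrA reG; have p1 := Re_le_nrm (phi a * conjc tau.1).
  move: p1; rewrite nrmM nrmJ tau1 mulr1 => /(le_trans (ler_norm _)) p1.
  have := sqr_ge0 (1 - nrm (phi a)); rewrite sqrrB expr1n mul1r; lra.
rewrite (model_diagonal Mu dt) in h.
have n1 : nrm a.1 ^+ 2 = (1 - t) ^+ 2.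
  by rewrite /a ray1 nrmM nrm_real tau1 mulr1 real_normK // num_real.
have n2 : 2 * t * weight M - t ^+ 2 * M ^+ 2 <= 1 - nrm a.2 ^+ 2.
  rewrite /a ray2 nrmM nrm_real exprMn real_normK ?num_real // /weight.
  case: eqP => [->|_].
    by rewrite expr1n mulr1 le_eqVlt; apply/orP; left; apply/eqP; ring.
  have := nrm_ge0 tau.2; set z := nrm _ => z0.
  have tM2 : 0 <= (1 - t * M) <= 1 by apply/andP; split; nra.
  have z1 : z ^+ 2 <= 1 by rewrite expr_le1.
  have s1 : (1 - t * M) ^+ 2 <= 1 by move/andP: tM2 => [? ?]; rewrite expr_le1.
  have : (1 - t * M) ^+ 2 * z ^+ 2 <= 1 by rewrite mulr_ile1 ?sqr_ge0.
  have := sqr_ge0 (t * M); rewrite exprMn; lra.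
rewrite n1 in h; rewrite -(ler_pM2l t0) nrm_comp_sqr -/a /wsq.
move: h n2; set A := nrm (P1 _) ^+ 2; set B := nrm (P2 _) ^+ 2.
have A0 : 0 <= A by exact: sqr_ge0. have B0 : 0 <= B by exact: sqr_ge0.
move=> h /(ler_wpM2r B0) n2.
have p1 : 0 <= t ^+ 2 * M ^+ 2 * A := mulr_ge0 (mulr_ge0 (sqr_ge0 _) (sqr_ge0 _)) A0.
have p2 : 0 <= t ^+ 2 * B := mulr_ge0 (sqr_ge0 _) B0.
move: h n2; lra.
Qed.

(** Along the ray in direction [(tau.1, tau.2 * M)] the model converges in norm;
    the limit has squared length [left_K phi tau M], and this number is also
    what it pairs to with the limits of the model along every tame filter. *)
Lemma direction_limit M : 0 < M -> exists w : H,
  [/\ (fun t => u (ray M t)) @ (0 : R)^'+ --> w,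
      left_K phi tau M = (wsq (weight M) w)%:C,
      forall F, Filter F -> tame F ->
        (fun k => wip (weight M) w (u k)) @ F --> ((wsq (weight M) w)%:C : C) &
      nrm tau.2 < 1 -> P2 w = 0].
Proof.
move=> M0; have Ft := ray_tameB M0; set m := weight M.
have m0 : 0 <= m by apply: weight_ge0; exact: ltW.
have [B B0 uB] := tame_model_bounded Mu Ft.
have uB' : \forall t \near (0 : R)^'+, bidisk (ray M t) /\ nrm (u (ray M t)) <= B := uB.
have tn := ray_near M0.
have Gs : \forall t \near (0 : R)^'+, forall F, Filter F -> tame F ->
    (fun k => wip m (u (ray M t)) (u k)) @ F --> slope M t.
  by apply: filterS2 uB' tn => t [dt _] /andP[t0 _] F FF FFt; exact: tame_slope.
have P2s : nrm tau.2 < 1 -> (fun t => P2 (u (ray M t))) @ (0 : R)^'+ --> 0.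
  by move=> t2; exact: (tame_small2 taubd Ft).
have [w [uw Gw]] : exists w : H, (fun t => u (ray M t)) @ (0 : R)^'+ --> w /\
    slope M @ (0 : R)^'+ --> ((wsq m w)%:C : C).
  apply: (@curve_limit _ _ _ _ _ _ (fun t => t * ((1 + M ^+ 2) / 2 * B ^+ 2)) _ _ _ B) => //.
  - by apply: filterS uB' => t [].
  - by apply: filterS Gs => t /(_ _ _ Ft).
  - apply: filterS2 uB' tn => t [_ tB] tM; apply: le_trans (slope_bound M0 tM) _.
    have /andP[t0 _] := tM; rewrite lerD2l ler_wpM2l ?(ltW t0) // ler_wpM2l //.
      by rewrite divr_ge0 // addr_ge0 // sqr_ge0.
    by rewrite ler_pXn2r ?nnegrE ?nrm_ge0.
  - rewrite -[X in _ --> X](mul0r ((1 + M ^+ 2) / 2 * B ^+ 2)).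
    by apply: cvgM; [exact: cvg_within|exact: cvg_cst].
  - rewrite /m /weight; case: eqP => [_|/eqP t2]; [by left|right].
    by apply: P2s; rewrite lt_neqAle t2; have [_ ->] := bd_le1 taubd.
exists w; split=> //.
- have tau1 := nrm_tau1.
  have t1n := tau1_neq0.
  have dl : (fun t : R => (t%:C)^-1 *:
        (phi (tau + t%:C *: - (tau.1, tau.2 * M%:C)) - boundary_value phi tau) : C)
      @ (0 : R)^'+ --> (- tau.1 * (wsq m w)%:C : C).
    pose proof (@cvg_mulC R _ _ _ (fun=> - tau.1 : C) _ _ _ (cvg_cst _) Gw) as h.
    apply: cvg_trans h; apply: near_eq_cvg; apply: filterS tn => t _.
    rewrite /slope phitau -/(ray M t) /GRing.scale /=.
    have := mulcJ tau.1; rewrite tau1 expr1n => e.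
    rewrite mulrA mulrBr mulr1 mulNr opprK mulrCA e mulr1 mulrC addrC.
    by [].
  rewrite /left_K /directional_derivative (cvg_lim (@norm_hausdorff _ _) dl) phitau.
  by rewrite mulrC mulKf // oppr_eq0.
- move=> F FF FFt; have [B' B'0 uBF] := tame_model_bounded Mu FFt.
  apply/cvg_nrmP => e e0.
  have e3 : 0 < e / 3 by rewrite divr_gt0.
  have c0 : 0 < (1 + m) * (1 + B') by rewrite mulr_gt0 //; lra.
  have e3c : 0 < e / 3 / ((1 + m) * (1 + B')) by rewrite divr_gt0.
  move/cvg_nrmP : uw => /(_ _ e3c) uw; move/cvg_nrmP : Gw => /(_ _ e3) Gw.
  pose proof (@filter_ex _ ((0 : R)^'+) _ _ (filterI (filterI uw Gw) Gs)) as [t [[ut Gt] Gst]].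
  move: (Gst _ FF FFt) => /cvg_nrmP/(_ _ e3); apply: filterS2 uBF => k [_ kB] kt.
  have -> : wip m w (u k) - (wsq m w)%:C =
     - wip m (u (ray M t) - w) (u k) + (wip m (u (ray M t)) (u k) - slope M t) +
     (slope M t - (wsq m w)%:C) by rewrite wipBl; ring.
  have h : nrm (wip m (u (ray M t) - w) (u k)) <= e / 3.
    apply: le_trans (wip_le _ _ m0) _; rewrite mulrAC.
    move: ut; rewrite ltr_pdivlMr // => ut; apply: le_trans (ltW ut).
    rewrite mulrC ler_wpM2l ?nrm_ge0 // ler_wpM2l //; lra.
  apply: le_lt_trans (ler_nrmD _ _) _.
  have := ler_nrmD (- wip m (u (ray M t) - w) (u k))
    (wip m (u (ray M t)) (u k) - slope M t).
  rewrite nrmN; lra.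
- move=> /P2s h; apply: (cvg_unique (@norm_hausdorff _ _)) h.
  exact: cvg_comp2.
Qed.

End Direction.

(** * Minimality of the limits along rays *)
Section Vectors.
Variables (R : realType) (phi : Cx2 R -> Cx R) (Mu : model phi).
Local Notation C := (Cx R).
Local Notation C2 := (Cx2 R).
Local Notation H := (model_space Mu).
Local Notation P1 := (@comp1 R phi Mu).
Local Notation P2 := (@comp2 R phi Mu).
Local Notation u := (model_map Mu).
Implicit Types (l k : C2) (x y v w : H).
Variable tau : C2.
Hypothesis Btau : is_Bpoint phi tau.
Hypothesis phitau : boundary_value phi tau = tau.1.
Local Notation tame := (@tame R phi tau).
Local Notation ray := (ray tau).
Local Notation weight := (weight tau).

Let taubd : bidisk_bd tau. Proof. by have [] := Btau. Qed.

(** Weak limits along filters rather than sequences: this includes both the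
    elements of [weak_limits] and the norm limits along rays. *)
Definition tame_limit_vector v := exists F, [/\ ProperFilter F, tame F &
  forall x, (fun k => ip (u k) x) @ F --> ip v x].

Definition direction_vector M w :=
  [/\ (fun t => u (ray M t)) @ (0 : R)^'+ --> w,
      left_K phi tau M = (wsq (weight M) w)%:C,
      forall F, Filter F -> tame F ->
        (fun k => wip (weight M) w (u k)) @ F --> ((wsq (weight M) w)%:C : C) &
      nrm tau.2 < 1 -> P2 w = 0].

Lemma weak_limits_tame v : weak_limits tau v -> tame_limit_vector v.
Proof.
move=> [l [lb ltau /pinfty_ex_gt0[X _ lX] lv]]; exists (l @ \oo); split.
- exact: fmap_proper_filter.
- split; first exact: ltau.
  exists X; change (\forall n \near \oo,
    bidisk (l n) /\ 1 - nrm (phi (l n)) <= X * (1 - nrm (l n))).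
  apply: nearW => n; split=> //.
  have l1 : 0 < 1 - nrm (l n) by rewrite subr_gt0; apply/bidisk_nrm.
  by rewrite -ler_pdivrMr // -quotientE; exact: le_trans (ler_norm _) (lX n I).
- exact: lv.
Qed.

Lemma cvg_ip_l T (F : set_system T) {FF : Filter F} (f : T -> H) x y :
  f @ F --> y -> (fun t => ip (f t) x) @ F --> ip y x.
Proof.
move=> fy; apply: (@cvg_nrm_le _ _ _ _ _ _ _ (fun t => nrm (f t - y) * nrm x)).
  by apply: filterS (@filterT _ F _) => t _; rewrite -ipBl CauchySchwarz_ip.
rewrite -[X in _ --> X](mul0r (nrm x)); apply: cvgM; last exact: cvg_cst.
exact/cvg_nrm0P.
Qed.

Lemma direction_vector_tame M w : 0 < M -> direction_vector M w -> tame_limit_vector w.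
Proof.
move=> M0 [uw _ _ _]; exists (ray M @ (0 : R)^'+); split.
- exact: fmap_proper_filter.
- exact: (ray_tameB Mu Btau).
- by move=> x; pose proof (@cvg_ip_l _ _ _ _ x _ uw) as h; exact: h.
Qed.

Lemma wip_limit M w v : direction_vector M w -> tame_limit_vector v ->
  wip (weight M) w v = (wsq (weight M) w)%:C.
Proof.
move=> [_ _ wF _] [F [FF Ft Fv]].
pose proof (wF F _ Ft) as h.
apply: (@cvg_nrm_unique R C _ F FF _ _ _ _ h); rewrite wipC wipE.
under eq_fun do rewrite wipC wipE.
pose proof (@cvg_mulC R _ F _ (fun=> (weight M)%:C) _ _ _ (cvg_cst _) (Fv (P2 w))) as h2.
pose proof (@cvgD _ C _ F _ _ _ _ _ (Fv (P1 w)) h2) as h12.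
exact: (cvg_conj h12).
Qed.

(** The squared length in a given direction is minimal at the limit along that
    direction. *)
Lemma wsq_minimal M w v : direction_vector M w -> tame_limit_vector v ->
  wsq (weight M) (v - w) = wsq (weight M) v - wsq (weight M) w.
Proof.
move=> dw tv; rewrite wsqB wipC (wip_limit dw tv) /=; ring.
Qed.

Lemma wsq_le M w v : 0 < M -> direction_vector M w -> tame_limit_vector v ->
  wsq (weight M) w <= wsq (weight M) v.
Proof.
move=> M0 dw tv; rewrite -subr_ge0 -(wsq_minimal dw tv) wsq_ge0 //.
by apply: weight_ge0; exact: ltW.
Qed.

(** If one limit has no second component then its pairing with every other one
    does not depend on the direction, which freezes [left_K]. *)
Lemma wsq_constant M N w v : 0 < M -> 0 < N ->
  direction_vector M w -> direction_vector N v -> P2 v = 0 ->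
  wsq (weight M) w = wsq (weight N) v.
Proof.
move=> M0 N0 dw dv v0.
have := wip_limit dw (direction_vector_tame N0 dv).
have := wip_limit dv (direction_vector_tame M0 dw).
rewrite /wip v0 ip0l ip0r !mulr0 !addr0 ipC => e1 e2.
by move: e1; rewrite e2 => /(congr1 (@complex.Re R)).
Qed.

(** A vector that is approximated in norm, with quotients bounded by one
    constant, is a weak limit: this allows a diagonal choice of points. *)
Lemma approx_weak_limits v (X : R) :
  (forall e, 0 < e -> exists l, [/\ bidisk l, nrm (l - tau) < e, nrm (u l - v) < e &
     caratheodory_quotient phi l <= X]) -> weak_limits tau v.
Proof.
move=> app.
have /choice[l hl] : forall n : nat, exists l, [/\ bidisk l, nrm (l - tau) < n.+1%:R^-1,
    nrm (u l - v) < n.+1%:R^-1 & caratheodory_quotient phi l <= X].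
  by move=> n; apply: app; rewrite invr_gt0.
have inv0 : (fun n : nat => n.+1%:R^-1 : R) @ \oo --> (0 : R) by exact: cvg_harmonic.
exists l; split.
- by move=> n; have [] := hl n.
- apply: (@cvg_nrm_le _ _ _ _ _ _ _ (fun n : nat => n.+1%:R^-1)) => //.
  by apply: filterS (@filterT _ \oo _) => n _; have [_ /ltW] := hl n.
- exists (`|X|); split=> [|Y XY n _ /=]; first exact: num_real.
  have [dl _ _ qX] := hl n; apply: le_trans (ltW XY).
  rewrite ger0_norm; first exact: le_trans qX (ler_norm _).
  rewrite quotientE divr_ge0 // subr_ge0 ?(phi_le1 Mu) //; exact/ltW/bidisk_nrm.
- move=> x; apply: cvg_ip_l.
  apply: (@cvg_nrm_le _ _ _ _ _ _ _ (fun n : nat => n.+1%:R^-1)) => //.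
  by apply: filterS (@filterT _ \oo _) => n _; have [_ _ /ltW] := hl n.
Qed.

Lemma direction_approx M w (X : R) : 0 < M -> direction_vector M w ->
  (\forall t \near (0 : R)^'+, caratheodory_quotient phi (ray M t) <= X) ->
  forall e, 0 < e -> exists l, [/\ bidisk l, nrm (l - tau) < e, nrm (u l - w) < e &
     caratheodory_quotient phi l <= X].
Proof.
move=> M0 [/cvg_nrmP uw _ _ _] qX e e0.
have [Ft _] := ray_tameB Mu Btau M0.
have rd : \forall t \near (0 : R)^'+, bidisk (ray M t).
  exact: (tame_bidisk (ray_tameB Mu Btau M0)).
move/cvg_nrmP : Ft => /(_ _ e0) rt.
have rt' : \forall t \near (0 : R)^'+, nrm (ray M t - tau) < e := rt.
pose proof (@filter_ex _ ((0 : R)^'+) _ _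
  (filterI (filterI rd rt') (filterI (uw _ e0) qX))) as ex.
have [t [[h1 h2] [h3 h4]]] := ex.
by exists (ray M t).
Qed.

Lemma direction_weak_limits M w : 0 < M -> direction_vector M w -> weak_limits tau w.
Proof.
move=> M0 dw; have [_ [X FX]] := ray_tameB Mu Btau M0.
apply: (@approx_weak_limits w X); apply: (direction_approx M0 dw).
have FX' : \forall t \near (0 : R)^'+, bidisk (ray M t) /\
   1 - nrm (phi (ray M t)) <= X * (1 - nrm (ray M t)) := FX.
apply: filterS FX' => t [dl qX].
by rewrite quotientE ler_pdivrMr // subr_gt0; apply/bidisk_nrm.
Qed.

(** For [M >= 1] one has 1 - nrm (ray M t) >= t / 2, whence a bound of the quotient
    along the ray that depends on [M] only through the weighted length of the limit. *)
Lemma direction_quotient M w : 1 <= M -> nrm tau.2 = 1 -> direction_vector M w ->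
  \forall t \near (0 : R)^'+, caratheodory_quotient phi (ray M t) <= 4 * (wsq M w + 1).
Proof.
move=> M1 t2 [uw _ _ _]; have M0 : 0 < M by lra.
have wsqu : (fun t => wsq M (u (ray M t))) @ (0 : R)^'+ --> wsq M w.
  apply: cvgD.
    by apply: cvgM; apply: cvg_nrm; exact: cvg_comp1.
  apply: cvgM; first exact: cvg_cst.
  by apply: cvgM; apply: cvg_nrm; exact: cvg_comp2.
have rd : \forall t \near (0 : R)^'+, bidisk (ray M t).
  exact: (tame_bidisk (ray_tameB Mu Btau M0)).
have tn := ray_near M0.
move/cvgrPdist_lt : wsqu => /(_ _ ltr01) wsqu.
near=> t.
have dt : bidisk (ray M t) by near: t; exact: rd.
have tM : 0 < t < (1 + M)^-1 by near: t; exact: tn.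
have : `|wsq M w - wsq M (u (ray M t))| < 1 by near: t; exact: wsqu.
rewrite ltr_norml => /andP[wl _].
have rn := ray_nrm taubd M0 tM; have [t0 _] := andP tM.
have h2 : 1 / 2 <= M / (1 + M) by rewrite ler_pdivlMr; lra.
have l1 : t / 2 <= 1 - nrm (ray M t).
  by apply: le_trans rn; rewrite ler_wpM2l ?(ltW t0) //; lra.
have l0 : 0 < 1 - nrm (ray M t) by rewrite subr_gt0; apply/bidisk_nrm.
rewrite quotientE ler_pdivrMr //.
have p1 := phi_le1 Mu dt; have p0 := nrm_ge0 (phi (ray M t)).
apply: (@le_trans _ _ (2 * t * wsq M (u (ray M t)))).
  apply: (@le_trans _ _ (1 - nrm (phi (ray M t)) ^+ 2)); first by nra.
  rewrite (model_diagonal Mu dt) /wsq mulrDr.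
  rewrite ray1 ray2 !nrmM !nrm_real t2 (nrm_tau1 Mu Btau phitau) !mulr1.
  rewrite !real_normK ?num_real //.
  set A := nrm (P1 _) ^+ 2; set B := nrm (P2 _) ^+ 2.
  have A0 : 0 <= A by exact: sqr_ge0.
  have B0 : 0 <= B by exact: sqr_ge0.
  have p3 : 0 <= t ^+ 2 * A := mulr_ge0 (sqr_ge0 _) A0.
  have p4 : 0 <= (t * M) ^+ 2 * B := mulr_ge0 (sqr_ge0 _) B0.
  by move: p3 p4; lra.
have w0 : 0 <= wsq M (u (ray M t)) by apply: wsq_ge0; lra.
apply: (@le_trans _ _ (4 * (wsq M w + 1) * (t / 2))); last by rewrite ler_wpM2l //; lra.
nra.
Unshelve. all: by end_near. Qed.

(** Move the second point of the model equation to [tau] along the ray. *)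
Lemma boundary_two_point M w l : 0 < M -> direction_vector M w -> bidisk l ->
  1 - phi l * conjc tau.1 = (1 - l.1 * conjc tau.1) * ip (P1 (u l)) (P1 w) +
                            (1 - l.2 * conjc tau.2) * ip (P2 (u l)) (P2 w) :> C.
Proof.
move=> M0 [uw _ _ _] dl; have rt := ray_tameB Mu Btau M0.
have ipr (P : H -> H) : (fun t => P (u (ray M t))) @ (0 : R)^'+ --> P w ->
    (fun t => ip (P (u l)) (P (u (ray M t)))) @ (0 : R)^'+ --> ip (P (u l)) (P w).
  move=> Pw; rewrite ipC; under eq_fun do rewrite ipC.
  by apply: cvg_conj; exact: cvg_ip_l.
have cph : (fun t => phi (ray M t)) @ (0 : R)^'+ --> tau.1.
  exact: (tame_phi Mu Btau phitau rt).
have c1 : (fun t => (ray M t).1) @ (0 : R)^'+ --> tau.1 by exact: (tame_cvg1 rt).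
have c2 : (fun t => (ray M t).2) @ (0 : R)^'+ --> tau.2 by exact: (tame_cvg2 rt).
have cst1 (a b : C) (f : R -> C) : f @ (0 : R)^'+ --> b ->
    (fun t => 1 - a * conjc (f t) : C) @ (0 : R)^'+ --> (1 - a * conjc b : C).
  move=> fb; apply: cvgB; first exact: cvg_cst.
  by apply: cvg_mulC; [exact: cvg_cst|exact: cvg_conj].
have lhs := cst1 (phi l) _ _ cph.
apply: (@cvg_nrm_unique R C _ _ _ _ _ _ lhs).
pose proof (@cvg_mulC R _ _ _ _ _ _ _ (cst1 l.1 _ _ c1) (ipr P1 (cvg_comp1 uw))) as r1.
pose proof (@cvg_mulC R _ _ _ _ _ _ _ (cst1 l.2 _ _ c2) (ipr P2 (cvg_comp2 uw))) as r2.
pose proof (@cvgD _ C _ _ _ _ _ _ _ r1 r2) as r.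
apply: cvg_trans r; apply: near_eq_cvg.
have rd : \forall t \near (0 : R)^'+, bidisk (ray M t) by exact: (tame_bidisk rt).
by apply: filterS rd => t dt; rewrite [RHS](model_two_point Mu dl dt).
Qed.

(** Without second component the previous identity reads
    phi l - tau.1 = (l.1 - tau.1) <u1 l, w1>, and the inner product tends to
    |w1|^2 nontangentially; the gradient is therefore (|w1|^2, 0). *)
Lemma Cpoint_of_direction M w : 0 < M -> direction_vector M w -> P2 w = 0 ->
  is_Cpoint phi tau.
Proof.
move=> M0 dw w0; split=> //; set a : C := (wsq (weight M) w)%:C.
exists (a, 0); apply/eqoP => e e0 /= S hS.
have [_ _ wF _] := dw.
have [F0 [FF0 F0t]] := Bpoint_tame Btau.
have St : tame (within S (nbhs tau)).
  apply: (nontangential_tame Mu taubd F0t hS); first exact: cvg_within.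
  exact: withinT.
have er : e = (complex.Re e)%:C by rewrite RRe_real // ger0_real // ltW.
have er0 : 0 < complex.Re e by rewrite -ltcR -er.
pose proof (wF _ _ St) as lim; move/cvg_nrmP : lim => /(_ _ er0).
have [Sb _ _] := hS.
have SS : within S (nbhs tau) S by exact: withinT.
apply: filterS2 SS => l Sl h; have dl := Sb _ Sl.
have tau1 := nrm_tau1 Mu Btau phitau.
have := boundary_two_point M0 dw dl; rewrite w0 ip0r mulr0 addr0.
set c := ip _ _ => e1.
have cw : nrm (c - a : C) < complex.Re e.
  suff -> : c - a = conjc (wip (weight M) w (u l) - a) :> C by rewrite nrmJ.
  rewrite rmorphB; congr (_ - _); last by symmetry; exact: conjc_real.
  by rewrite /= -wipC /wip w0 ip0r mulr0 addr0.
have tt : tau.1 * conjc tau.1 = 1 by rewrite mulcJ tau1 expr1n.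
have -> : phi l - boundary_value phi tau - a * (l.1 - tau.1) - 0 * (l.2 - tau.2) =
    (l.1 - tau.1) * (c - a).
  rewrite phitau mul0r subr0.
  have -> : phi l - tau.1 = - tau.1 * (1 - phi l * conjc tau.1).
    have -> : - tau.1 * (1 - phi l * conjc tau.1) = phi l * (tau.1 * conjc tau.1) - tau.1.
      by ring.
    by rewrite tt mulr1.
  rewrite e1 mulrA.
  have -> : - tau.1 * (1 - l.1 * conjc tau.1) = l.1 - tau.1.
    have -> : - tau.1 * (1 - l.1 * conjc tau.1) = l.1 * (tau.1 * conjc tau.1) - tau.1 by ring.
    by rewrite tt mulr1.
  by ring.
rewrite !nrmE er -rmorphM lecR nrmM mulrC ler_pM ?nrm_ge0 ?(ltW cw) //.
by rewrite (nrm_pair (l - tau)) le_max lexx.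
Qed.

(** Rays approach [tau] nontangentially, so an angular gradient computes the
    directional derivatives, which are then linear in the direction. *)
Lemma Cpoint_affine : is_Cpoint phi tau -> exists a b : C,
  forall M, 0 < M -> left_K phi tau M = a + M%:C * b.
Proof.
move=> [_ [eta /eqoP oeta]].
have tau1 := nrm_tau1 Mu Btau phitau.
have t1n := tau1_neq0 Mu Btau phitau.
exists eta.1, (eta.2 * tau.2 / tau.1) => M M0.
suff dl : (fun t : R => (t%:C)^-1 *:
        (phi (tau + t%:C *: - (tau.1, tau.2 * M%:C)) - boundary_value phi tau) : C)
      @ (0 : R)^'+ --> (- (eta.1 * tau.1 + eta.2 * (tau.2 * M%:C)) : C).
  rewrite /left_K /directional_derivative (cvg_lim (@norm_hausdorff _ _) dl) phitau.
  by field.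
apply/cvg_nrmP => e e0.
have M1 : 0 < 1 + M by lra.
have eM : (0 : R[i]) < (e / 2 / (1 + M))%:C by rewrite ltcR !divr_gt0.
have [Ft _] := ray_tameB Mu Btau M0.
have := oeta _ eM _ (ray_nontangential taubd M0) => /Ft h.
have h' : \forall t \near (0 : R)^'+, ray_set tau M (ray M t) ->
  `|phi (ray M t) - boundary_value phi tau - eta.1 * ((ray M t).1 - tau.1)
       - eta.2 * ((ray M t).2 - tau.2) : C| <= (e / 2 / (1 + M))%:C * `|ray M t - tau| := h.
apply: filterS2 h' (ray_near M0) => t {}h tM.
have {h} := h (ex_intro2 _ _ t tM erefl).
move/andP : tM => [t0 _]; rewrite !nrmE -rmorphM lecR => h.
have rd := ray_dist taubd (ltW t0) (ltW M0).
rewrite -/(ray M t) phitau opprK; rewrite phitau in h.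
have tn : (t%:C : C) != 0 by rewrite -[0]/(0%:C) (inj_eq (@complexI R)) gt_eqF.
have -> : (t%:C)^-1 *: (phi (ray M t) - tau.1) + (eta.1 * tau.1 + eta.2 * (tau.2 * M%:C)) =
  (t%:C)^-1 * (phi (ray M t) - tau.1 - eta.1 * ((ray M t).1 - tau.1)
       - eta.2 * ((ray M t).2 - tau.2)) :> C.
  by rewrite ray1 ray2 !rmorphB rmorphM /= rmorph1 /GRing.scale /=; field.
rewrite nrmM -fmorphV nrm_real ger0_norm ?invr_ge0 ?(ltW t0) // mulrC ltr_pdivrMr //.
apply: le_lt_trans h _; rewrite nrmBC.
apply: (@le_lt_trans _ _ (e / 2 / (1 + M) * (t * (1 + M)))).
  by rewrite ler_wpM2l // !divr_ge0 // ltW.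
have -> : e / 2 / (1 + M) * (t * (1 + M)) = e / 2 * t by field; rewrite gt_eqF.
nra.
Qed.

End Vectors.

(** * Classification of the boundary point *)
Section Cases.
Variables (R : realType) (phi : Cx2 R -> Cx R) (Mu : model phi).
Local Notation C := (Cx R).
Local Notation C2 := (Cx2 R).
Local Notation H := (model_space Mu).
Local Notation P1 := (@comp1 R phi Mu).
Local Notation P2 := (@comp2 R phi Mu).
Local Notation u := (model_map Mu).
Implicit Types (l k : C2) (x y v w : H).
Variable tau : C2.
Hypothesis Btau : is_Bpoint phi tau.
Hypothesis phitau : boundary_value phi tau = tau.1.
Local Notation tame := (@tame R phi tau).
Local Notation ray := (ray tau).
Local Notation weight := (weight tau).

Let taubd : bidisk_bd tau. Proof. by have [] := Btau. Qed.

Variable W : R -> H.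
Hypothesis WP : forall M, 0 < M -> direction_vector tau M (W M).
Definition limit_sq M : R := wsq (weight M) (W M).
Local Notation K := limit_sq.

Lemma left_KE M : 0 < M -> left_K phi tau M = (K M)%:C.
Proof. by move=> M0; have [] := WP M0. Qed.

Lemma left_K_eq1 M : 0 < M -> left_K phi tau M = 1 <-> K M = 1.
Proof.
move=> M0; rewrite left_KE //; split => [|->//].
by move=> /(congr1 (@complex.Re R)).
Qed.

Lemma left_K_lt1 M : 0 < M -> left_K phi tau M < 1 <-> K M < 1.
Proof. by move=> M0; rewrite left_KE // -[1 : R[i]]/(1%:C) ltcR. Qed.

Lemma left_K_gt1 M : 0 < M -> 1 < left_K phi tau M <-> 1 < K M.
Proof. by move=> M0; rewrite left_KE // -[1 : R[i]]/(1%:C) ltcR. Qed.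

Lemma left_K_constantP : (exists k : R[i], forall M, 0 < M -> left_K phi tau M = k) <->
  (forall M N, 0 < M -> 0 < N -> K M = K N).
Proof.
split=> [[k hk] M N M0 N0|h].
  by apply: complexI; rewrite -!left_KE // !hk.
by exists (K 1)%:C => M M0; rewrite left_KE // (h M 1).
Qed.

Lemma left_K_constant_le1P :
  (exists2 a : R, a <= 1 & forall M, 0 < M -> left_K phi tau M = a%:C) <->
  (forall M N, 0 < M -> 0 < N -> K M = K N) /\ K 1 <= 1.
Proof.
split=> [[a a1 ha]|[h K1]].
  have Ka M : 0 < M -> K M = a by move=> M0; apply: complexI; rewrite -left_KE // ha.
  by split=> [M N M0 N0|]; rewrite !Ka.
by exists (K 1) => // M M0; rewrite left_KE // (h M 1).
Qed.

Lemma W_tame M : 0 < M -> tame_limit_vector tau (W M).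
Proof. by move=> M0; exact: (direction_vector_tame Btau M0 (WP M0)). Qed.

Lemma K_le M v : 0 < M -> tame_limit_vector tau v -> K M <= wsq (weight M) v.
Proof. by move=> M0; exact: wsq_le M0 (WP M0). Qed.

Lemma K_constant N : 0 < N -> P2 (W N) = 0 -> forall M M', 0 < M -> 0 < M' -> K M = K M'.
Proof.
move=> N0 WN M M' M0 M'0.
rewrite /limit_sq (wsq_constant Btau M0 N0 (WP M0) (WP N0) WN).
by rewrite (wsq_constant Btau M'0 N0 (WP M'0) (WP N0) WN).
Qed.

Lemma typeI_vector : left_typeI Mu tau ->
  exists2 v, tame_limit_vector tau v & nrm (P1 v) <= 1 /\ P2 v = 0.
Proof.
move=> [_ _ _ _ [v wv [v1 v2]]]; exists v; first exact: weak_limits_tame wv.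
split=> //.
by rewrite -lecR -nrmE.
Qed.

Lemma typeI_intro v : weak_limits tau v -> nrm (P1 v) <= 1 -> P2 v = 0 -> left_typeI Mu tau.
Proof.
move=> wv v1 v2; split=> //.
- by rewrite /circle /= nrmE (nrm_tau1 Mu Btau phitau).
- move=> A; have [F [FF Ft]] := Bpoint_tame Btau.
  move=> VA; have FA : \forall l \near F, A l.2 by exact: (tame_cvg2 Ft VA).
  have bF : \forall l \near F, bidisk l by exact: (tame_bidisk Ft).
  have [l [Al [_ dl]]] := filter_ex (filterI FA bF).
  by exists l.2.
- by exists v => //; split=> //; rewrite nrmE -[1 : R[i]]/(1%:C) lecR.
Qed.

Lemma typeI_K_le1 M : left_typeI Mu tau -> 0 < M -> K M <= 1.
Proof.
move=> /typeI_vector[v tv [v1 v2]] M0; apply: le_trans (K_le M0 tv) _.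
by rewrite /wsq v2 nrm0 expr0n mulr0 addr0 expr_le1 // nrm_ge0.
Qed.

Lemma Cpoint_of_constant M : 0 < M -> P2 (W M) = 0 -> is_Cpoint phi tau.
Proof. by move=> M0; exact: (Cpoint_of_direction Btau phitau M0 (WP M0)). Qed.

Section Face.
Hypothesis tau2 : nrm tau.2 < 1.

Lemma face_comp2 M : 0 < M -> P2 (W M) = 0.
Proof. by move=> M0; have [_ _ _] := WP M0; apply. Qed.

Lemma face_typeI : left_typeI Mu tau <-> K 1 <= 1.
Proof.
split=> [h|]; first exact: typeI_K_le1.
rewrite /limit_sq /wsq face_comp2 // nrm0 expr0n mulr0 addr0 expr_le1 ?nrm_ge0 // => h.
exact: typeI_intro (direction_weak_limits Btau ltr01 (WP ltr01)) h (face_comp2 ltr01).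
Qed.

End Face.

Section Torus.
Hypothesis tau2 : nrm tau.2 = 1.

Lemma torus_weight M : weight M = M.
Proof. by rewrite /weight tau2 eqxx. Qed.

Lemma KE M : K M = nrm (P1 (W M)) ^+ 2 + M * nrm (P2 (W M)) ^+ 2.
Proof. by rewrite /limit_sq torus_weight. Qed.

Lemma K_le_affine M N : 0 < M -> 0 < N ->
  K M <= nrm (P1 (W N)) ^+ 2 + M * nrm (P2 (W N)) ^+ 2.
Proof. by move=> M0 N0; apply: le_trans (K_le M0 (W_tame N0)) _; rewrite torus_weight. Qed.

Lemma K_le_shift M N : 0 < M -> 0 < N -> K M <= K N + (M - N) * nrm (P2 (W N)) ^+ 2.
Proof. by move=> M0 N0; have := K_le_affine M0 N0; have := KE N; lra. Qed.

Lemma K_nondecreasing M N : 0 < N -> N <= M -> K N <= K M.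
Proof.
move=> N0 NM; have M0 : 0 < M by exact: lt_le_trans NM.
have := K_le_shift N0 M0; have := sqr_ge0 (nrm (P2 (W M))).
set b := nrm _ ^+ 2 => b0 h; have : (N - M) * b <= 0 by rewrite mulr_le0_ge0 //; lra.
lra.
Qed.

Lemma K_comp2 M : 0 < M -> M * nrm (P2 (W M)) ^+ 2 <= K M.
Proof. by move=> M0; rewrite KE lerDr sqr_ge0. Qed.

Lemma constant_comp2 N : (forall M N, 0 < M -> 0 < N -> K M = K N) -> 0 < N -> P2 (W N) = 0.
Proof.
move=> cst N0; have N2 : 0 < N / 2 by rewrite divr_gt0.
have := K_le_shift N2 N0; rewrite (cst _ _ N2 N0) => h.
have := sqr_ge0 (nrm (P2 (W N))) => b0.
apply: nrm_eq0; apply/eqP; rewrite -sqrf_eq0 eq_le b0 andbT; nra.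
Qed.

(** As the direction tends to the second axis, the limits along the rays form a
    Cauchy family and their second components vanish, by the bounds
    [|W1_M - W1_N|^2 <= K M - K N] and [M * |W2_M|^2 <= K M]. *)
Lemma typeI_of_K_le1 : (forall M, 0 < M -> K M <= 1) -> left_typeI Mu tau.
Proof.
move=> K1; pose M_ n : R := n.+1%:R.
have M0 n : 0 < M_ n by rewrite ltr0n.
have Kmono : {homo (fun n => K (M_ n)) : n m / (n <= m)%N >-> n <= m}.
  by move=> n m nm; apply: K_nondecreasing => //; rewrite ler_nat ltnS.
have Kub : has_ubound (range (fun n => K (M_ n))).
  by exists 1 => _ [n _ <-]; exact: K1.
have Kcv := nondecreasing_cvgn Kmono Kub.
set kk := sup _ in Kcv.
have Kle n : K (M_ n) <= kk by apply: ub_le_sup => //; exists n.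
have P1B n m : (n <= m)%N -> nrm (P1 (W (M_ m)) - P1 (W (M_ n))) ^+ 2 <= K (M_ m) - K (M_ n).
  move=> nm; have := wsq_minimal (WP (M0 n)) (W_tame (M0 m)).
  rewrite torus_weight {1}/wsq comp1B => e.
  apply: (@le_trans _ _ (wsq (M_ n) (W (M_ m)) - wsq (M_ n) (W (M_ n)))).
    by rewrite -e lerDl mulr_ge0 ?sqr_ge0 // ltW.
  rewrite /limit_sq !torus_weight lerD2r /wsq lerD2l ler_wpM2r ?sqr_ge0 //.
  by rewrite ler_nat ltnS.
have [v P1v] : exists v, (fun n => P1 (W (M_ n))) @ \oo --> v.
  apply: hilbert_cauchy => e e0.
  have e2 : 0 < e ^+ 2 by rewrite exprn_gt0.
  move/cvgrPdist_lt : Kcv => /(_ _ e2)[n _ hn].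
  exists (P1 (W (M_ n))); exists n => // m /= nm.
  rewrite -(@ltr_pXn2r _ 2) ?nnegrE ?nrm_ge0 // ?(ltW e0) //.
  apply: le_lt_trans (P1B _ _ nm) _.
  have := hn n (leqnn n); rewrite ltr_norml; have := Kle m => /= h /andP[_]; lra.
have P20 : (fun n => P2 (W (M_ n))) @ \oo --> 0.
  apply/cvg_nrmP => e e0.
  have e2 : 0 < e ^+ 2 by rewrite exprn_gt0.
  have := @cvg_harmonic R => /cvgrPdist_lt/(_ _ e2); apply: filterS => n.
  rewrite /harmonic /= sub0r normrN ger0_norm ?invr_ge0 // => h.
  rewrite subr0 -(@ltr_pXn2r _ 2) ?nnegrE ?nrm_ge0 // ?(ltW e0) //.
  apply: le_lt_trans h; rewrite -(ler_pM2l (M0 n)) mulfV ?gt_eqF //.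
  exact: le_trans (K_comp2 (M0 n)) (K1 _ (M0 n)).
have Wv : (fun n => W (M_ n)) @ \oo --> v.
  pose proof (@cvgD _ H _ _ _ _ _ _ _ P1v P20) as h; rewrite addr0 in h.
  apply: cvg_trans h; apply: near_eq_cvg; apply: nearW => n.
  by have [_ _ ->] := projectionP (model_decomposition Mu) (W (M_ n)).
have v2 : P2 v = 0.
  pose proof (cvg_comp2 Wv) as h; exact: (cvg_nrm_unique h P20).
have v1 : nrm (P1 v) <= 1.
  apply: le_trans (nrm_comp1_le v) _.
  pose proof (cvg_nrm P1v) as h; rewrite -(cvg_lim _ h) //.
  apply: limr_le; first by apply/cvg_ex; eexists; exact: h.
  apply: nearW => n; rewrite -(@expr_le1 _ 2) ?nrm_ge0 //.
  apply: le_trans (K1 _ (M0 n)); rewrite KE lerDl mulr_ge0 ?sqr_ge0 //; exact: ltW.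
apply: (typeI_intro _ v1 v2); apply: (@approx_weak_limits _ _ _ _ v 8) => e e0.
have e2 : 0 < e / 2 by rewrite divr_gt0.
move/cvg_nrmP : Wv => /(_ _ e2)[n _ /(_ n (leqnn n)) /= nv].
have M1 : 1 <= M_ n by rewrite ler1n.
have qX : \forall t \near (0 : R)^'+, caratheodory_quotient phi (ray (M_ n) t) <= 8.
  pose proof (direction_quotient Btau phitau M1 tau2 (WP (M0 n))) as q.
  apply: filterS q => t /le_trans; apply.
  have := K1 _ (M0 n); rewrite /limit_sq torus_weight; lra.
have [l [dl lt lu lq]] := direction_approx Btau (M0 n) (WP (M0 n)) qX e2.
exists l; split=> //; first by apply: lt_le_trans lt _; lra.
rewrite -(subrK (W (M_ n)) (u l)) -addrA (le_lt_trans (ler_nrmD _ _)) //.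
by rewrite [ltRHS]splitr ltrD.
Qed.

Lemma typeIP : left_typeI Mu tau <-> forall M, 0 < M -> K M <= 1.
Proof. by split=> [h M|]; [exact: typeI_K_le1|exact: typeI_of_K_le1]. Qed.

(** An affine function that stays between 0 and 1 on the half-line is constant. *)
Lemma typeI_Cpoint_constant : left_typeI Mu tau -> is_Cpoint phi tau ->
  forall M N, 0 < M -> 0 < N -> K M = K N.
Proof.
move=> /typeIP K1 /(Cpoint_affine Mu Btau phitau)[a [b Kab]].
have K0 M : 0 < M -> 0 <= K M.
  by move=> M0; apply: wsq_ge0; apply: weight_ge0; exact: ltW.
suff b0 : b = 0.
  by move=> M N M0 N0; apply: complexI; rewrite -!left_KE // !Kab // b0 !mulr0.
apply: (@nrm_eq0 R C); apply/eqP; rewrite eq_le nrm_ge0 andbT.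
apply: contraT; rewrite -ltNge => b0.
(* For this M the bound |M b| <= K M + |a| <= 1 + |a| fails. *)
pose M := (2 + nrm a) / nrm b.
have M0 : 0 < M by rewrite divr_gt0 //; have := nrm_ge0 a; lra.
have e : M%:C * b = (K M)%:C - a :> C by rewrite -left_KE // Kab // addrC addKr.
have := ler_nrmB ((K M)%:C : C) a.
rewrite -e nrmM !nrm_real (ger0_norm (ltW M0)) (ger0_norm (K0 _ M0)).
have -> : M * nrm b = 2 + nrm a by rewrite /M divfK // gt_eqF.
by have := K1 _ M0; lra.
Qed.

(** By minimality |v - w_M|_M^2 = |v|_M^2 - K M <= 1 - 1 for a Type I vector [v],
    so w_M = v has no second component. *)
Lemma typeI_strict M : left_typeI Mu tau -> 0 < M -> K M = 1 ->
  forall M N, 0 < M -> 0 < N -> K M = K N.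
Proof.
move=> /typeI_vector[v tv [v1 v2]] M0 KM; apply: (K_constant M0).
have := wsq_minimal (WP M0) tv; rewrite -/(limit_sq M) KM torus_weight /wsq.
rewrite comp1B comp2B v2 sub0r nrmN nrm0 expr0n mulr0 addr0 => e.
have h1 : nrm (P1 v) ^+ 2 <= 1 by rewrite expr_le1 // nrm_ge0.
have h2 := sqr_ge0 (nrm (P1 v - P1 (W M))).
have h3 := sqr_ge0 (nrm (P2 (W M))).
apply: nrm_eq0; apply/eqP; rewrite -sqrf_eq0 eq_le h3 andbT; nra.
Qed.

(** The slope of [K] at [M] is at most |W2 M|^2 <= K M / M, which makes [K]
    continuous at the supremum of the set where it is at most 1. *)
Lemma K_intermediate N0 N1 : 0 < N0 -> K N0 <= 1 -> 0 < N1 -> 1 <= K N1 ->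
  exists2 A, 0 < A & K A = 1.
Proof.
move=> N00 KN0 N10 KN1.
pose S := [set M | 0 < M /\ K M <= 1].
have [KN1e|KN1n] := eqVneq (K N1) 1; first by exists N1.
have KN1' : 1 < K N1 by rewrite lt_neqAle eq_sym KN1n.
have SN0 : S N0 by [].
have Sub : ubound S N1.
  move=> M [M0 KM]; rewrite leNgt; apply/negP => /ltW /(K_nondecreasing N10).
  by move: KM KN1'; lra.
have Ssup : has_sup S by split; [exists N0|exists N1].
have A0 : 0 < sup S by apply: lt_le_trans N00 _; apply: ub_le_sup => //; exists N1.
exists (sup S) => //; apply/eqP; rewrite eq_le; apply/andP; split.
- apply/ler_addgt0Pr => e e0.
  pose d := Num.min (sup S / 2) (e * sup S / 2).
  have d0 : 0 < d by rewrite lt_min !divr_gt0 ?mulr_gt0.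
  have d1 : d <= sup S / 2 by rewrite ge_min lexx.
  have d2 : d <= e * sup S / 2 by rewrite ge_min lexx orbT.
  have [M [M0 KM] AM] := sup_adherent d0 Ssup.
  have := K_le_shift A0 M0; have := K_comp2 M0; have := sqr_ge0 (nrm (P2 (W M))).
  set b := nrm _ ^+ 2 => b0 bM h.
  have hb : sup S / 2 * b <= 1.
    by apply: le_trans (le_trans bM KM); rewrite ler_wpM2r //; lra.
  have : (sup S - M) * b <= (e * sup S / 2) * b by rewrite ler_wpM2r //; lra.
  have : e * (sup S / 2 * b) <= e by rewrite ler_piMr // ltW.
  lra.
- rewrite leNgt; apply/negP => KA.
  have := sqr_ge0 (nrm (P2 (W (sup S)))); set b := nrm _ ^+ 2 => b0.
  (* The slope bound [b] at the supremum keeps [K] at most 1 up to [sup S + d]. *)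
  pose d := (1 - K (sup S)) / (b + 1).
  have d0 : 0 < d by rewrite divr_gt0 //; lra.
  have M0 : 0 < sup S + d by exact: addr_gt0.
  have dle : (b + 1) * d = 1 - K (sup S) by rewrite /d mulrC divfK // gt_eqF //; lra.
  have KMle : K (sup S + d) <= 1 by have := K_le_shift M0 A0; rewrite -/b; nra.
  have : sup S + d <= sup S by apply: ub_le_sup => //; exists N1.
  lra.
Qed.

Lemma typeIIP : left_typeII Mu tau <->
  ~ (forall M N, 0 < M -> 0 < N -> K M = K N) /\ exists2 A, 0 < A & K A = 1.
Proof.
split=> [[_ _ _ [v wv v1] nI]|[nc [A A0 KA]]].
- have tv := weak_limits_tame wv; have {}v1 : nrm (P1 v) < 1 by rewrite -ltcR -nrmE.
  have n1 := nrm_ge0 (P1 v); have n2 := sqr_ge0 (nrm (P2 v)).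
  (* M is so small that |v1|^2 + M |v2|^2 < 1. *)
  pose M := (1 - nrm (P1 v) ^+ 2) / (2 * (nrm (P2 v) ^+ 2 + 1)).
  have s1 : nrm (P1 v) ^+ 2 < 1 by rewrite expr_lt1.
  have M0 : 0 < M by rewrite divr_gt0 //; lra.
  have KM : K M < 1.
    apply: le_lt_trans (K_le M0 tv) _; rewrite torus_weight /wsq.
    have e : M * (2 * (nrm (P2 v) ^+ 2 + 1)) = 1 - nrm (P1 v) ^+ 2.
      by rewrite /M divfK // gt_eqF //; lra.
    by have := ltW M0; nra.
  split.
    move=> cst; apply: nI; apply/typeIP => N N0; rewrite (cst N M) //; exact: ltW.
  have [N N0 KN] : exists2 N, 0 < N & 1 <= K N.
    apply: contrapT => no; apply: nI; apply/typeIP => N N0; rewrite leNgt.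
    by apply/negP => /ltW KN; apply: no; exists N.
  exact: (K_intermediate M0 (ltW KM) N0 KN).
- split=> //; first by rewrite /circle /= !nrmE (nrm_tau1 Mu Btau phitau) tau2.
  + exists (W A); first exact: (direction_weak_limits Btau A0 (WP A0)).
    rewrite nrmE -[1 : R[i]]/(1%:C) ltcR -(@expr_lt1 _ 2) ?nrm_ge0 //.
    have b0 : 0 < nrm (P2 (W A)) ^+ 2.
      rewrite lt_def sqr_ge0 andbT sqrf_eq0; apply/eqP => /nrm_eq0 b0.
      exact: nc (K_constant A0 b0).
    have e := KE A; rewrite KA in e; have := mulr_gt0 A0 b0; lra.
  + by move=> I; apply: nc; exact: (typeI_strict I A0 KA).
Qed.

End Torus.
End Cases.

Section Left.
Variables (R : realType) (phi : Cx2 R -> Cx R) (Mu : model phi) (tau : Cx2 R).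
Hypothesis Btau : is_Bpoint phi tau.
Hypothesis phitau : boundary_value phi tau = tau.1.

Let constant_le1 := exists2 a : R, a <= 1 &
  forall M : R, 0 < M -> left_K phi tau M = a%:C.
Let nonconstant := ~ (exists k : R[i],
  forall M : R, 0 < M -> left_K phi tau M = k).

Lemma direction_vectors : exists W : R -> model_space Mu,
  forall M, 0 < M -> direction_vector tau M (W M).
Proof.
have /choice[W hW] : forall M : R,
    exists w : model_space Mu, 0 < M -> direction_vector tau M w.
  move=> M; have [M0|M0] := pselect (0 < M); last by exists 0.
  by have [w hw] := direction_limit Mu Btau phitau M0; exists w.
by exists W.
Qed.

Lemma left_face : nrm tau.2 < 1 ->
  (left_typeI Mu tau /\ is_Cpoint phi tau <-> constant_le1) /\
  (~ (left_typeI Mu tau /\ is_Cpoint phi tau) ->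
     ~ left_typeI Mu tau /\ ~ left_typeII Mu tau).
Proof.
move=> t2; have [W WP] := direction_vectors.
have w0 := face_comp2 WP t2 ltr01.
have cst := K_constant Btau WP ltr01 w0.
have Cp := Cpoint_of_constant Btau phitau WP ltr01 w0.
have tI := face_typeI Btau phitau WP t2.
split; last first.
  move=> no; split; first by move=> I; apply: no.
  by move=> [[_ ]]; rewrite /circle /= nrmE => /complexI e; move: t2; rewrite e ltxx.
rewrite /constant_le1 (left_K_constant_le1P WP); split=> [[/tI]|[_ /tI]] //.
Qed.

Lemma left_torus : nrm tau.2 = 1 ->
  [/\ left_typeI Mu tau /\ is_Cpoint phi tau <-> constant_le1,
      left_typeI Mu tau /\ ~ is_Cpoint phi tau <->
        nonconstant /\ (forall M : R, 0 < M -> left_K phi tau M < 1),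
      left_typeII Mu tau <->
        nonconstant /\ (exists2 A : R, 0 < A & left_K phi tau A = 1) &
      ~ left_typeI Mu tau /\ ~ left_typeII Mu tau <->
        (forall M : R, 0 < M -> 1 < left_K phi tau M)].
Proof.
move=> t2; have [W WP] := direction_vectors.
have tI := typeIP Btau phitau WP t2; have tII := typeIIP Btau phitau WP t2.
have IC := typeI_Cpoint_constant Btau phitau WP t2.
have cstC : (forall M N, 0 < M -> 0 < N -> limit_sq tau W M = limit_sq tau W N) ->
    is_Cpoint phi tau.
  move=> cst; have w0 := constant_comp2 Btau WP t2 cst ltr01.
  exact: (Cpoint_of_constant Btau phitau WP ltr01 w0).
have nonE : nonconstant <->
    ~ (forall M N, 0 < M -> 0 < N -> limit_sq tau W M = limit_sq tau W N).
  by rewrite /nonconstant (left_K_constantP WP).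
split.
- rewrite /constant_le1 (left_K_constant_le1P WP); split.
    by move=> [I Cp]; split; [exact: IC|move/tI : I; apply].
  by move=> [cst K1]; split; [apply/tI => M M0; rewrite (cst M 1)|exact: cstC].
- rewrite nonE; split.
    move=> [I nC]; split; first by move=> /cstC.
    move=> M M0; apply/(left_K_lt1 WP M0); rewrite lt_neqAle; apply/andP; split.
      by apply/eqP => K1; apply: nC; apply: cstC; exact: (typeI_strict Btau WP t2 I M0 K1).
    by move/tI : I; apply.
  move=> [nc K1]; have I : left_typeI Mu tau.
    by apply/tI => M M0; apply: ltW; apply/(left_K_lt1 WP M0); exact: K1.
  by split=> // Cp; apply: nc; exact: IC.
- rewrite nonE tII; split=> -[nc [A A0 KA]]; split=> //; exists A => //.
    exact/(left_K_eq1 WP A0).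
  exact/(left_K_eq1 WP A0).
- split.
    move=> [nI nII] M M0; apply/(left_K_gt1 WP M0); rewrite ltNge; apply/negP => KM.
    have [N N0 KN] : exists2 N, 0 < N & 1 <= limit_sq tau W N.
      apply: contrapT => no; apply: nI; apply/tI => N N0; rewrite leNgt.
      by apply/negP => /ltW KN; apply: no; exists N.
    apply: nII; apply/tII; split; last exact: (K_intermediate Btau WP t2 M0 KM N0 KN).
    by move=> cst; apply: nI; apply/tI => M' M'0; rewrite (cst M' M).
  move=> K1; split.
    by move/tI/(_ 1 ltr01); apply/negP; rewrite -ltNge; apply/(left_K_gt1 WP ltr01); exact: K1.
  move/tII => [_ [A A0 KA]]; have := K1 _ A0.
  by move/(left_K_gt1 WP A0); rewrite KA ltxx.
Qed.

End Left.

(** * Exchanging the coordinates *)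
Section Swap.
Variable R : realType.
Local Notation C := (Cx R).
Local Notation C2 := (Cx2 R).
Implicit Types (phi : C2 -> C) (l tau : C2) (S A : set C2).

Definition swap2 l : C2 := (l.2, l.1).

Lemma swap2K : involutive swap2. Proof. by case. Qed.

Lemma swap_argsK phi : swap_args (swap_args phi) = phi.
Proof. by apply/funext => -[]. Qed.

Lemma norm_swap2 l : `|swap2 l| = `|l|.
Proof. by rewrite !nrmE !nrm_pair /= maxC. Qed.

Lemma bidisk_swap2 l : bidisk (swap2 l) <-> bidisk l.
Proof. by split=> -[]. Qed.

Lemma cvg_swap2 tau : swap2 @ tau --> swap2 tau.
Proof.
apply/cvgrPdist_lt => e e0.
have cid : id @ tau --> tau by exact: cvg_id.
move/cvgrPdist_lt : cid => /(_ _ e0); apply: filterS => l.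
by rewrite -norm_swap2.
Qed.

Lemma nbhs_swap2 tau A : nbhs (swap2 tau) A <-> nbhs tau (swap2 @^-1` A).
Proof.
split=> [/cvg_swap2//|/= h].
have := @cvg_swap2 (swap2 tau); rewrite swap2K => /(_ _ h) /=.
by rewrite /nbhs /=; apply: filterS => l /=; rewrite swap2K.
Qed.

Lemma within_bidisk_swap2 tau A :
  within (@bidisk R) (nbhs (swap2 tau)) A <-> within (@bidisk R) (nbhs tau) (swap2 @^-1` A).
Proof.
change (nbhs (swap2 tau) [set l | bidisk l -> A l] <->
        nbhs tau [set l | bidisk l -> A (swap2 l)]).
rewrite (propext (nbhs_swap2 _ _)); suff -> : swap2 @^-1` [set l | bidisk l -> A l] =
  [set l | bidisk l -> A (swap2 l)] by [].
by apply/funext => l; rewrite /= (propext (bidisk_swap2 l)).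
Qed.

Lemma bidisk_bd_swap2 tau : bidisk_bd tau -> bidisk_bd (swap2 tau).
Proof.
move=> [clo nint]; split.
  by move=> A /nbhs_swap2 /clo[l [/bidisk_swap2 dl Al]]; exists (swap2 l).
by move=> /nbhs_swap2 h; apply: nint; apply: filterS h => l /bidisk_swap2.
Qed.

Lemma approaches_swap2 S tau : approaches_nontangentially S tau ->
  approaches_nontangentially (swap2 @^-1` S) (swap2 tau).
Proof.
move=> [Sb clo [c c0 Sc]]; split.
- by move=> l /= /Sb /bidisk_swap2.
- move=> A /nbhs_swap2 /clo[l [Sl Al]]; exists (swap2 l); split=> //=.
  by rewrite swap2K.
- exists c => // l /= /Sc; rewrite norm_swap2.
  by rewrite -(norm_swap2 (_ - _)) /swap2 /=.
Qed.

Lemma nontangential_swap2 tau A :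
  nontangential (swap2 tau) A <-> nontangential tau (swap2 @^-1` A).
Proof.
have half t B : nontangential (swap2 t) B -> nontangential t (swap2 @^-1` B).
  move=> h S /approaches_swap2 /h /nbhs_swap2; apply: filterS => l /=.
  by rewrite swap2K.
split; first exact: half.
rewrite -{1}(swap2K tau) => /half; congr nontangential.
by apply/funext => l /=; rewrite swap2K.
Qed.

Lemma boundary_value_swap phi tau :
  boundary_value (swap_args phi) (swap2 tau) = boundary_value phi tau.
Proof.
have E : fmap (swap_args phi) (nontangential (swap2 tau)) = fmap phi (nontangential tau).
  apply/funext => A; apply/propext.
  have := nontangential_swap2 tau (swap_args phi @^-1` A).
  suff -> : swap2 @^-1` (swap_args phi @^-1` A) = phi @^-1` A by [].
  by apply/funext => l; rewrite /= /swap_args /= -surjective_pairing.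
exact: (congr1 (fun F : set_system C => lim F) E).
Qed.

Lemma image_swap2 T (f : C2 -> T) A : (f \o swap2) @` A = f @` (swap2 @^-1` A).
Proof.
apply/seteqP; split=> _ [l Al <-]; exists (swap2 l); rewrite /= ?swap2K //.
Qed.

Lemma preimage_swap2K A : swap2 @^-1` (swap2 @^-1` A) = A.
Proof. by apply/funext => l; rewrite /= swap2K. Qed.

Lemma limf_esup_swap2 (f : C2 -> \bar R) tau :
  limf_esup (f \o swap2) (within (@bidisk R) (nbhs (swap2 tau))) =
  limf_esup f (within (@bidisk R) (nbhs tau)).
Proof.
rewrite /limf_esup; congr ereal_inf; apply/seteqP; split=> _ [A FA <-].
- by exists (swap2 @^-1` A); [exact/within_bidisk_swap2|rewrite image_swap2].
- exists (swap2 @^-1` A); last by rewrite image_swap2 preimage_swap2K.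
  by apply/within_bidisk_swap2; rewrite preimage_swap2K.
Qed.

Lemma Bpoint_swap phi tau : is_Bpoint phi tau -> is_Bpoint (swap_args phi) (swap2 tau).
Proof.
move=> [bd fin]; split; first exact: bidisk_bd_swap2.
move: fin; rewrite /limf_einf -limf_esup_swap2.
suff -> : (\- (fun l => (caratheodory_quotient phi l)%:E))%E \o swap2 =
    (\- (fun l => (caratheodory_quotient (swap_args phi) l)%:E))%E by [].
by apply/funext => l; rewrite /= /caratheodory_quotient norm_swap2.
Qed.

Lemma Cpoint_swap_half phi tau : is_Cpoint phi tau -> is_Cpoint (swap_args phi) (swap2 tau).
Proof.
move=> [B [eta /eqoP h]]; split; first exact: Bpoint_swap.
exists (swap2 eta); apply/eqoP => e /h{}h /=.
apply/nontangential_swap2; apply: (@filterS _ (nontangential tau) _ _ _ _ h) => l hl.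
have e1 : swap_args phi (swap2 l) = phi l by exact: (congr1 phi (swap2K l)).
change (`|swap_args phi (swap2 l) - boundary_value (swap_args phi) (swap2 tau)
  - eta.2 * (l.2 - tau.2) - eta.1 * (l.1 - tau.1) : C| <= e * `|swap2 (l - tau)|).
by rewrite e1 boundary_value_swap norm_swap2 addrAC.
Qed.

Lemma Cpoint_swap phi tau : is_Cpoint (swap_args phi) (swap2 tau) <-> is_Cpoint phi tau.
Proof.
split; last exact: Cpoint_swap_half.
by move=> /Cpoint_swap_half; rewrite swap_argsK swap2K.
Qed.

Lemma right_KE phi tau M : right_K phi tau M = left_K (swap_args phi) (swap2 tau) M.
Proof.
by rewrite /right_K /left_K /directional_derivative boundary_value_swap.
Qed.

End Swap.

Theorem theorem2p11 (R : realType) :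
  (forall (phi : Cx2 R -> Cx R) (Mu : model phi) (tau : Cx2 R),
     schur_class phi ->
     ~ (forall l, bidisk l -> phi l = l.1) ->
     is_Bpoint phi tau ->
     boundary_value phi tau = tau.1 ->
     let constant_le1 := exists2 a : R, a <= 1 &
       forall M : R, 0 < M -> left_K phi tau M = a%:C in
     let nonconstant := ~ (exists k : R[i],
       forall M : R, 0 < M -> left_K phi tau M = k) in
     (`|tau.2| < 1 ->
        (left_typeI Mu tau /\ is_Cpoint phi tau <-> constant_le1) /\
        (~ (left_typeI Mu tau /\ is_Cpoint phi tau) ->
           ~ left_typeI Mu tau /\ ~ left_typeII Mu tau)) /\
     (`|tau.2| = 1 ->
        [/\ left_typeI Mu tau /\ is_Cpoint phi tau <-> constant_le1,
            left_typeI Mu tau /\ ~ is_Cpoint phi tau <->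
              nonconstant /\ (forall M : R, 0 < M -> left_K phi tau M < 1),
            left_typeII Mu tau <->
              nonconstant /\ (exists2 A : R, 0 < A & left_K phi tau A = 1) &
            ~ left_typeI Mu tau /\ ~ left_typeII Mu tau <->
              (forall M : R, 0 < M -> 1 < left_K phi tau M)])) /\
  (forall (phi : Cx2 R -> Cx R) (Mu : model (swap_args phi)) (tau : Cx2 R),
     schur_class phi ->
     ~ (forall l, bidisk l -> phi l = l.2) ->
     is_Bpoint phi tau ->
     boundary_value phi tau = tau.2 ->
     let constant_le1 := exists2 a : R, a <= 1 &
       forall M : R, 0 < M -> right_K phi tau M = a%:C in
     let nonconstant := ~ (exists k : R[i],
       forall M : R, 0 < M -> right_K phi tau M = k) in
     (`|tau.1| < 1 ->
        (right_typeI Mu tau /\ is_Cpoint phi tau <-> constant_le1) /\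
        (~ (right_typeI Mu tau /\ is_Cpoint phi tau) ->
           ~ right_typeI Mu tau /\ ~ right_typeII Mu tau)) /\
     (`|tau.1| = 1 ->
        [/\ right_typeI Mu tau /\ is_Cpoint phi tau <-> constant_le1,
            right_typeI Mu tau /\ ~ is_Cpoint phi tau <->
              nonconstant /\ (forall M : R, 0 < M -> right_K phi tau M < 1),
            right_typeII Mu tau <->
              nonconstant /\ (exists2 A : R, 0 < A & right_K phi tau A = 1) &
            ~ right_typeI Mu tau /\ ~ right_typeII Mu tau <->
              (forall M : R, 0 < M -> 1 < right_K phi tau M)])).
Proof.
split=> phi Mu tau _ _ Btau phitau.
- split=> t2.
  + by apply: left_face => //; rewrite -ltcR -nrmE.
  + by apply: left_torus => //; apply: complexI; rewrite -nrmE.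
- have Bs := Bpoint_swap Btau.
  have phis : boundary_value (swap_args phi) (swap2 tau) = (swap2 tau).1.
    by rewrite boundary_value_swap.
  have KE : right_K phi tau = left_K (swap_args phi) (swap2 tau).
    by apply/funext => M; exact: right_KE.
  have CE : is_Cpoint phi tau = is_Cpoint (swap_args phi) (swap2 tau).
    by apply/propext; exact: (iff_sym (Cpoint_swap phi tau)).
  rewrite KE CE; split=> t2.
  + by apply: (left_face Mu Bs phis); rewrite -ltcR -nrmE.
  + by apply: (left_torus Mu Bs phis); apply: complexI; rewrite -nrmE.
Qed.
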